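(* Let $\mathcal H_1,\mathcal H_2$ be Hilbert spaces, $A$ a self-adjoint operator in $\mathcal H_1$ bounded from below, $B$ a densely defined closable operator from $\mathcal H_2$ to $\mathcal H_1$, and $D$ a self-adjoint operator in $\mathcal H_2$ bounded from above; let $\mathfrak a$, $\mathfrak d$ be the closed quadratic forms associated with $A$, $D$. Assume that $\mathrm{dom}(\mathfrak a)\subset\mathrm{dom}(B^* )$ and that either (I) $\mathrm{dom}(B)\subset\mathrm{dom}(D)$ and $\mathrm{dom}(B)$ is a core for $D$, or (II) $\mathrm{dom}(\mathfrak d)\subset\mathrm{dom}(B)$. Let $\mathcal M$ be the closure of $\mathcal M_0=\begin{pmatrix}A&B\\-B^*&D\end{pmatrix}$ with $\mathrm{dom}(\mathcal M_0)=(\mathrm{dom}(A)\cap\mathrm{dom}(B^* ))\times(\mathrm{dom}(B)\cap\mathrm{dom}(D))$ in $\mathcal H_1\oplus\mathcal H_2$, and let $S(z)$, $z\in\mathbb U$, be the Schur complement. Then $$\sigma(S)=\sigma(\mathcal M)\cap\mathbb U,\qquad \sigma_{\rm p}(S)=\sigma_{\rm p}(\mathcal M)\cap\mathbb U,$$ $$\dim\ker S(z)=\dim\ker(\mathcal M-z)\qquad\text{for } z\in\mathbb U.$$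
   Context: Hilbert spaces are non-zero and complex; inner products are linear in the first argument. The form $\mathfrak a$ has domain $\mathrm{dom}(|A|^{1/2})$, with sesquilinear form $\mathfrak a[x,y]$ and $\mathfrak a[x]=\mathfrak a[x,x]$; $\mathfrak d$ has domain $\mathrm{dom}(|D|^{1/2})$. Under the stated assumptions $\mathcal M_0$ is closable. $\sigma_{\rm p}$ denotes the set of eigenvalues. Since $\mathrm{dom}(\mathfrak a)\subset\mathrm{dom}(B^* )$, there exist $a\in\mathbb R$, $b\ge0$ with $\|B^*x\|^2\le a\|x\|^2+b\,\mathfrak a[x]$ for all $x\in\mathrm{dom}(\mathfrak a)$; let $b_0$ be the infimum of all $b\ge0$ for which such an $a\in\mathbb R$ exists. Set $\mathbb U=\{z\in\mathbb C:\mathrm{dist}(z,\sigma(D))>b_0\}$. For $z\in\mathbb U$ let $$\mathfrak s(z)[x,y]=\mathfrak a[x,y]-z\langle x,y\rangle+\langle(D-z)^{-1}B^*x,B^*y\rangle,\qquad x,y\in\mathrm{dom}(\mathfrak s(z))=\mathrm{dom}(\mathfrak a),$$ which is a closed sectorial form; $S(z)$ is the m-sectorial operator associated with it (first representation theorem). One sets $\sigma(S)=\{z\in\mathbb U:0\in\sigma(S(z))\}$ and $\sigma_{\rm p}(S)=\{z\in\mathbb U:0\in\sigma_{\rm p}(S(z))\}$. *)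

(* Defs.v *)
From HB Require Import structures.
From mathcomp Require Import all_boot all_order all_algebra all_real_closed.
From mathcomp Require Import all_classical all_reals all_analysis.

Set Implicit Arguments.
Unset Strict Implicit.
Unset Printing Implicit Defensive.

Import Order.TTheory GRing.Theory Num.Theory Num.Def numFieldNormedType.Exports.

Local Open Scope classical_set_scope.
Local Open Scope ring_scope.
Local Open Scope complex_scope.

(* The order on R[i] is the partial one: x <= y means that y - x is a
   nonnegative real number.  An inequality between complex expressions
   therefore also asserts that their difference is real. *)

(* [{dot H for conjC}] is linear in the first argument and conjugate-linear in
   the second one. *)
HB.mixin Record CompleteNormedModule_isHilbert (R : realType) H
    of CompleteNormedModule R[i] H := {
  inner : {dot H for @conjC R[i]} ;
  inner_norm : forall x : H, inner x x = `|x| ^+ 2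
}.

#[short(type="hilbertType")]
HB.structure Definition Hilbert (R : realType) :=
  {H of CompleteNormedModule R[i] H & CompleteNormedModule_isHilbert R H}.

Notation "''[' x , y ]" := (inner x%R y%R)
  (format "''[' x ,  y ]") : ring_scope.

(* Unbounded operators are represented by their graphs.  An arbitrary
   [T : operator V W] is just a relation; [linear_operator T] says that it is
   the graph of a linear operator. *)
Definition operator (V W : Type) := set (V * W).

Section Operators.
Context {R : realType}.
Implicit Types U V W : normedModType R[i].

Definition dom V W (T : operator V W) : set V :=
  [set x | exists y, T (x, y)].

(* value of [T] at [x]; meaningful for x in the domain of a single-valued T *)
Definition app V W (T : operator V W) (x : V) : W :=
  xget 0 [set y | T (x, y)].

Definition single_valued V W (T : operator V W) :=
  forall x y y', T (x, y) -> T (x, y') -> y = y'.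

Definition linear_operator V W (T : operator V W) :=
  [/\ T (0, 0),
      forall (c : R[i]) p q, T p -> T q -> T (c *: p + q) &
      single_valued T].

Definition densely_defined V W (T : operator V W) := dense (dom T).

(* [closure T], the topological closure of the graph in V * W, is the graph of
   the closure of [T] when the latter exists. *)
Definition closable V W (T : operator V W) := single_valued (closure T).

Definition restrict_op V W (T : operator V W) (E : set V) : operator V W :=
  [set p | T p /\ E p.1].

Definition is_core V W (T : operator V W) (E : set V) :=
  E `<=` dom T /\ closure (restrict_op T E) = T.

Definition opp_op V W (T : operator V W) : operator V W :=
  [set p | T (p.1, - p.2)].

Definition comp_op U V W (S : operator V W) (T : operator U V) :
    operator U W :=
  [set p | exists2 y, T (p.1, y) & S (y, p.2)].

Definition inv_op V W (T : operator V W) : operator W V :=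
  [set p | T (p.2, p.1)].

(* T - z *)
Definition shift_op V (T : operator V V) (z : R[i]) : operator V V :=
  [set p | T (p.1, p.2 + z *: p.1)].

Definition ker_op V W (T : operator V W) : set V := [set x | T (x, 0)].

Definition resolvent_set V (T : operator V V) : set R[i] :=
  [set z | (forall y, exists! x, shift_op T z (x, y)) /\
           exists c : R, forall x y,
             shift_op T z (x, y) -> `|x| <= c%:C * `|y|].

Definition spectrum V (T : operator V V) : set R[i] := ~` resolvent_set T.

Definition point_spectrum V (T : operator V V) : set R[i] :=
  [set z | exists2 x, x != 0 & T (x, z *: x)].

(* [hamel_basis E X]: X is an algebraic basis of the linear subspace E. *)
Definition hamel_basis V (E X : set V) :=
  [/\ X `<=` E,
      forall n (v : 'I_n -> V) (c : 'I_n -> R[i]),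
        injective v -> (forall i, X (v i)) ->
        \sum_(i < n) c i *: v i = 0 -> forall i, c i = 0 &
      forall x, E x -> exists n (v : 'I_n -> V) (c : 'I_n -> R[i]),
        (forall i, X (v i)) /\ x = \sum_(i < n) c i *: v i].

(* Equality of dimensions, as cardinals. *)
Definition dim_eq V W (E : set V) (F : set W) :=
  exists X Y, [/\ hamel_basis E X, hamel_basis F Y & (X #= Y)%card].

Definition dist (z : R[i]) (E : set R[i]) : R :=
  inf [set Normc.normc (z - w) | w in E].

End Operators.

Section HilbertOperators.
Context {R : realType}.
Implicit Types H K : hilbertType R.

Definition adjoint H K (T : operator H K) : operator K H :=
  [set p | forall u v, T (u, v) -> '[v, p.1] = '[u, p.2]].

Definition self_adjoint H (T : operator H H) :=
  [/\ linear_operator T, densely_defined T & adjoint T = T].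

Definition bounded_below H (T : operator H H) :=
  exists c : R, forall x y, T (x, y) -> c%:C * `|x| ^+ 2 <= '[y, x].

Definition bounded_above H (T : operator H H) :=
  exists c : R, forall x y, T (x, y) -> '[y, x] <= c%:C * `|x| ^+ 2.

(* [Q] is the nonnegative self-adjoint square root of [T]. *)
Definition is_sqrt H (T Q : operator H H) :=
  [/\ self_adjoint Q, (forall x y, Q (x, y) -> 0 <= '[y, x]) &
      comp_op Q Q = T].

(* |T| = (T^* T)^(1/2) *)
Definition is_abs H (T P : operator H H) :=
  is_sqrt (comp_op (adjoint T) T) P.

(* the domain of |T|^(1/2) *)
Definition abs_sqrt_dom H (T : operator H H) : set H :=
  [set x | exists P Q, [/\ is_abs T P, is_sqrt P Q & dom Q x]].

(* A sesquilinear form; its values outside [fdom] are irrelevant. *)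
Record sesq H := Sesq { fdom : set H ; fval :> H -> H -> R[i] }.

Definition opp_form H (f : sesq H) : sesq H :=
  Sesq (fdom f) (fun x y => - f x y).

Definition symmetric_sesq H (f : sesq H) :=
  [/\ fdom f 0,
      forall (c : R[i]) x y, fdom f x -> fdom f y -> fdom f (c *: x + y),
      forall (c : R[i]) x y w, fdom f x -> fdom f y -> fdom f w ->
        f (c *: x + y) w = c * f x w + f y w &
      forall x y, fdom f x -> fdom f y -> f y x = conjC (f x y)].

Definition form_bounded_below H (f : sesq H) :=
  exists c : R, forall x, fdom f x -> c%:C * `|x| ^+ 2 <= f x x.

Definition form_closed H (f : sesq H) :=
  forall (u : nat -> H) (x : H),
    (forall n, fdom f (u n)) -> u @ \oo --> x ->
    (forall e : R, 0 < e ->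
       \forall m & n \near \oo, `|f (u m - u n) (u m - u n)| < e%:C) ->
    fdom f x /\
    (forall e : R, 0 < e ->
       \forall n \near \oo, `|f (u n - x) (u n - x)| < e%:C).

(* The operator associated with a densely defined form [f]: T x = w if and only
   if x is in fdom f and f[x, y] = <w, y> for all y in fdom f. *)
Definition operator_of_form H (f : sesq H) : operator H H :=
  [set p | fdom f p.1 /\ forall y, fdom f y -> f p.1 y = '[p.2, y]].

(* [f] is the closed form associated with the self-adjoint operator [T], which
   is bounded from below. *)
Definition closed_form_of H (T : operator H H) (f : sesq H) :=
  [/\ fdom f = abs_sqrt_dom T,
      symmetric_sesq f,
      form_bounded_below f,
      form_closed f &
      operator_of_form f = T].

End HilbertOperators.

Section Schur.
Context {R : realType} {H1 H2 : hilbertType R}.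
Variables (A : operator H1 H1) (B : operator H2 H1) (D : operator H2 H2).
Variable a : sesq H1.

(* H1 (+) H2 is H1 * H2.  The library's norm on the product is the maximum norm,
   which is equivalent to the Hilbert norm; closures, spectra and kernels of
   operators are the same for both. *)
Definition block_op : operator (H1 * H2)%type (H1 * H2)%type :=
  [set p | exists Ax By Bsx Dy,
     [/\ A (p.1.1, Ax), B (p.1.2, By), adjoint B (p.1.1, Bsx),
         D (p.1.2, Dy) & p.2 = (Ax + By, - Bsx + Dy)]].

Definition relative_bound : R :=
  inf [set b : R | 0 <= b /\ exists al : R, forall x, fdom a x ->
         `|app (adjoint B) x| ^+ 2 <= al%:C * `|x| ^+ 2 + b%:C * a x x].

Definition schur_domain : set R[i] :=
  [set z | relative_bound < dist z (spectrum D)].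

Definition schur_form (z : R[i]) : sesq H1 :=
  Sesq (fdom a) (fun x y => a x y - z * '[x, y] +
    '[app (inv_op (shift_op D z)) (app (adjoint B) x), app (adjoint B) y]).

Definition schur_complement (z : R[i]) : operator H1 H1 :=
  operator_of_form (schur_form z).

Definition schur_spectrum : set R[i] :=
  [set z | schur_domain z /\ spectrum (schur_complement z) 0].

Definition schur_point_spectrum : set R[i] :=
  [set z | schur_domain z /\ point_spectrum (schur_complement z) 0].

End Schur.

(* Main.v *)
(* The closure of the block matrix is computed explicitly.  By the gliding hump
   argument [B^*] is bounded on [dom a] for the form norm, so for [z] in [U] there
   are [b < d], [d] the distance from [z] to the spectrum of [D], and a shift [k]
   with [|B^* x|^2 <= b (a + k)[x]].  As [|(D - z)^-1| <= 1 / d], the form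
   [s(z)] is coercive up to a multiple of [|x|^2]; hence reading the first row of
   the block matrix in the form sense gives a closed operator, and it is contained
   in the closure because the first row can be solved for [A] by Riesz.  Eliminating
   the second component turns [(M - z)(x, y) = (f, 0)] into [S(z) x = f], which
   gives kernels and eigenvalues; a right-hand side [g] in the second row is
   absorbed by solving the coercive shift of [s(z)], a contraction argument. *)
Require Import Defs.
From mathcomp Require Import all_boot all_order all_algebra all_real_closed.
From mathcomp Require Import all_classical all_reals all_analysis.
From mathcomp Require Import ring lra.

Set Implicit Arguments.
Unset Strict Implicit.
Unset Printing Implicit Defensive.

Import Order.TTheory GRing.Theory Num.Theory Num.Def numFieldNormedType.Exports.

Local Open Scope classical_set_scope.
Local Open Scope ring_scope.
Local Open Scope complex_scope.

(** The bound on the resolvent of [D] is derived without functional calculus. For real [m], a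
    resolvent norm above [1 / d] would turn near-maximisers of this norm into approximate
    eigenvectors of [(D - m)^2], for a value at which the shifted square is bounded below. For
    complex [z] the imaginary part is split off by Pythagoras. The right-hand side [g] of the second
    row needs separate care: the functional that sends [w] to ['[Rz g, Bs w]] is controlled by the
    form norm only, so in general it is not given by a vector of [H1] to which the inverse of [S(z)]
    could be applied. For the same reason [y] can be bounded only after the form norm of [x] has
    been. The alternatives (I) and (II) are reduced to one property: the graph of [D] is
    approximated by pairs of that graph whose first component lies in [dom B]. Estimates and
    variational arguments use real parts; complex identities are recovered by testing with
    ['i w]. *)

Section RealParts.
Variable R : realType.
Implicit Types (x y z : R[i]) (t : R).

Lemma ReD x y : complex.Re (x + y) = complex.Re x + complex.Re y.
Proof. by case: x; case: y. Qed.

Lemma ReN x : complex.Re (- x) = - complex.Re x.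
Proof. by case: x. Qed.

Lemma Re_scale t x : complex.Re (t%:C * x) = t * complex.Re x.
Proof. by case: x => a b /=; rewrite mul0r subr0. Qed.

Lemma Re_conj x : complex.Re (conjC x) = complex.Re x.
Proof. by case: x. Qed.

Lemma conjC_real t : conjC t%:C = t%:C.
Proof. by apply/eqP; rewrite eq_complex /= oppr0 !eqxx. Qed.

Lemma Re_mul_conji x : complex.Re ((conjC 'i%C) * x) = complex.Im x.
Proof. by case: x => a b /=; rewrite !mul0r sub0r mulN1r opprK. Qed.

Lemma ge0_RRe x : 0 <= x -> x = (complex.Re x)%:C.
Proof. by move=> x0; rewrite RRe_real// ger0_real. Qed.

Lemma gt0_RRe x : 0 < x -> exists2 t, 0 < t & x = t%:C.
Proof.
by move=> x0; exists (complex.Re x); [rewrite -ltcR|]; rewrite -ge0_RRe// ltW.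
Qed.

Lemma ltr0c t : (0 < t%:C) = (0 < t).
Proof. exact: (ltcR 0). Qed.

(** No sign of [r] is presupposed. For [0 < r] the minimiser is inserted; otherwise boundedness
    below leaves only [q = 0]. *)
Lemma quad_discr (p q r : R) :
  (forall t, 0 <= p + 2 * t * q + t ^+ 2 * r) -> q ^+ 2 <= p * r.
Proof.
move=> h.
have p0 : 0 <= p by have := h 0; rewrite mulr0 mul0r expr0n mul0r !addr0.
have [r0|r0] := ltP 0 r.
  have := h (- q / r).
  rewrite (_ : _ + _ = (p * r - q ^+ 2) / r); last by field; rewrite gt_eqF.
  by rewrite pmulr_lge0 ?invr_gt0// subr_ge0.
have [q0|q0] := eqVneq q 0.
  rewrite {}q0 in h *.
  have [->|r1] := eqVneq r 0; first by rewrite expr0n mulr0.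
  have := h (1 - p / r).
  rewrite (_ : _ + _ = r - p + p ^+ 2 / r); last by field.
  suff : p ^+ 2 / r <= 0 by lra.
  by rewrite mulr_ge0_le0 ?sqr_ge0// invr_le0.
(* This [t] makes the affine part equal to [-1], and the quadratic part is at most 0. *)
have := h (- (p + 1) / (2 * q)).
rewrite (_ : 2 * _ * q = - (p + 1)); last by field.
have : 0 <= (- (p + 1) / (2 * q)) ^+ 2 by exact: sqr_ge0.
nra.
Qed.

End RealParts.

(** * Positive symmetric forms and their seminorms *)

Section PositiveForm.
Variables (R : realType) (H : hilbertType R).

Definition rform (f : sesq H) (x y : H) : R := complex.Re (f x y).
Definition fnorm (f : sesq H) (x : H) : R := Num.sqrt (rform f x x).

Variable f : sesq H.
Hypothesis f_sym : symmetric_sesq f.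

Lemma fdom0 : fdom f 0. Proof. by case: f_sym. Qed.

Lemma fdomZD c x y : fdom f x -> fdom f y -> fdom f (c *: x + y).
Proof. by case: f_sym => _ h _ _; exact: h. Qed.

Lemma fdomZ c x : fdom f x -> fdom f (c *: x).
Proof. by move=> fx; have := fdomZD c fx fdom0; rewrite addr0. Qed.

Lemma fdomD x y : fdom f x -> fdom f y -> fdom f (x + y).
Proof. by move=> fx /(fdomZD 1 fx); rewrite scale1r. Qed.

Lemma fdomN x : fdom f x -> fdom f (- x).
Proof. by rewrite -scaleN1r; exact: fdomZ. Qed.

Lemma fdomB x y : fdom f x -> fdom f y -> fdom f (x - y).
Proof. by move=> xf /fdomN; exact: fdomD. Qed.

Lemma fformZDl c x y w : fdom f x -> fdom f y -> fdom f w ->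
  f (c *: x + y) w = c * f x w + f y w.
Proof. by case: f_sym => _ _ h _; exact: h. Qed.

Lemma fform_conj x y : fdom f x -> fdom f y -> f y x = conjC (f x y).
Proof. by case: f_sym => _ _ _ h; exact: h. Qed.

Lemma fform0l w : fdom f w -> f 0 w = 0.
Proof.
by move=> fw; have := fformZDl (-1) fdom0 fdom0 fw; rewrite scaler0 addr0 mulN1r addNr.
Qed.

Lemma fformDl x y w : fdom f x -> fdom f y -> fdom f w ->
  f (x + y) w = f x w + f y w.
Proof. by move=> fx fy fw; rewrite -{1}(scale1r x) fformZDl// mul1r. Qed.

Lemma fformZl c x w : fdom f x -> fdom f w -> f (c *: x) w = c * f x w.
Proof.
by move=> fx fw; rewrite -{1}(addr0 (c *: x)) fformZDl ?fform0l ?addr0//; exact: fdom0.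
Qed.

Lemma fformBl x y w : fdom f x -> fdom f y -> fdom f w ->
  f (x - y) w = f x w - f y w.
Proof.
by move=> fx fy fw; rewrite -scaleN1r fformDl ?fformZl ?mulN1r//; exact: fdomZ.
Qed.

Lemma fformZr c x w : fdom f x -> fdom f w -> f w (c *: x) = conjC c * f w x.
Proof.
by move=> fx fw; rewrite (fform_conj (fdomZ c fx) fw) fformZl// rmorphM/= -fform_conj.
Qed.

Lemma rformC x y : fdom f x -> fdom f y -> rform f y x = rform f x y.
Proof. by move=> fx fy; rewrite /rform (fform_conj fx fy) Re_conj. Qed.

Lemma rformDl x y w : fdom f x -> fdom f y -> fdom f w ->
  rform f (x + y) w = rform f x w + rform f y w.
Proof. by move=> *; rewrite /rform fformDl// ReD. Qed.

Lemma rformBl x y w : fdom f x -> fdom f y -> fdom f w ->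
  rform f (x - y) w = rform f x w - rform f y w.
Proof. by move=> *; rewrite /rform fformBl// ReD ReN. Qed.

Lemma rformZl (t : R) x w : fdom f x -> fdom f w ->
  rform f (t%:C *: x) w = t * rform f x w.
Proof. by move=> *; rewrite /rform fformZl// Re_scale. Qed.

Lemma rform_quad (t : R) x y : fdom f x -> fdom f y ->
  rform f (x + t%:C *: y) (x + t%:C *: y) =
  rform f x x + 2 * t * rform f x y + t ^+ 2 * rform f y y.
Proof.
move=> fx fy; have fty := fdomZ t%:C fy; have fs := fdomD fx fty.
rewrite rformDl// rformZl// (rformC fs fx) (rformC fs fy) !rformDl// !rformZl//.
rewrite (rformC fx fy); ring.
Qed.

Hypothesis f_pos : forall x, fdom f x -> 0 <= rform f x x.

Lemma fnorm_ge0 x : 0 <= fnorm f x. Proof. exact: sqrtr_ge0. Qed.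
Hint Resolve fnorm_ge0 : core.

Lemma fnorm_sqr x : fdom f x -> fnorm f x ^+ 2 = rform f x x.
Proof. by move=> /f_pos ?; rewrite sqr_sqrtr. Qed.

Lemma rform_CS x y : fdom f x -> fdom f y -> `|rform f x y| <= fnorm f x * fnorm f y.
Proof.
move=> fx fy; rewrite -(ler_pXn2r (n := 2))// ?nnegrE ?mulr_ge0//.
rewrite exprMn !fnorm_sqr// real_normK ?num_real//.
apply: quad_discr => t; rewrite -rform_quad//.
by apply: f_pos; exact: fdomD (fdomZ _ _).
Qed.

Lemma fnormD x y : fdom f x -> fdom f y -> fnorm f (x + y) <= fnorm f x + fnorm f y.
Proof.
move=> fx fy; rewrite -(ler_pXn2r (n := 2))// ?nnegrE ?addr_ge0//.
rewrite fnorm_sqr; last exact: fdomD.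
have := rform_quad 1 fx fy; rewrite scale1r => ->.
have := rform_CS fx fy; rewrite ler_norml => /andP[_].
rewrite -!fnorm_sqr//; nra.
Qed.

Lemma fformxx x : fdom f x -> f x x = (fnorm f x ^+ 2)%:C.
Proof.
move=> fx; rewrite fnorm_sqr// /rform.
have := fform_conj fx fx; case: (f x x) => u v [] /eqP.
by rewrite -addr_eq0 -mulr2n mulrn_eq0/= => /eqP ->.
Qed.

Lemma fnormZ c x : fdom f x -> fnorm f (c *: x) = Normc.normc c * fnorm f x.
Proof.
move=> fx; have fcx := fdomZ c fx; rewrite /fnorm /rform fformZl// fformZr//.
rewrite fformxx//; case: c {fcx} => u v /=.
rewrite (_ : _ - _ = (u ^+ 2 + v ^+ 2) * fnorm f x ^+ 2); last by ring.
by rewrite sqrtrM ?addr_ge0 ?sqr_ge0// sqrtr_sqr ger0_norm.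
Qed.

Lemma fnormN x : fdom f x -> fnorm f (- x) = fnorm f x.
Proof. by move=> fx; rewrite -scaleN1r fnormZ// normcN Normc.normc1 mul1r. Qed.

Lemma fnormBC x y : fdom f x -> fdom f y -> fnorm f (x - y) = fnorm f (y - x).
Proof. by move=> fx fy; rewrite -opprB fnormN//; exact: fdomB. Qed.

Lemma fnorm0 : fnorm f 0 = 0.
Proof. by rewrite -(scale0r 0) fnormZ ?Normc.normc0 ?mul0r//; exact: fdom0. Qed.

Lemma fnorm_distD y x z : fdom f x -> fdom f y -> fdom f z ->
  fnorm f (x - z) <= fnorm f (x - y) + fnorm f (y - z).
Proof.
move=> fx fy fz; rewrite (_ : x - z = (x - y) + (y - z)); last by rewrite addrA subrK.
by apply: fnormD; exact: fdomB.
Qed.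

End PositiveForm.

(** * The Hilbert norm, its topology and closures of graphs *)

Section HilbertNorm.
Variables (R : realType) (H : hilbertType R).
Implicit Types x y : H.

(** Viewed as a form, the inner product inherits all the seminorm lemmas, and the resulting norm
    [hn] takes values in [R] instead of [R[i]]. *)
Definition inner_form : sesq H := Sesq setT (fun x y => '[x, y]).

Lemma inner_sym : symmetric_sesq inner_form.
Proof.
split=> //= [c x y w _ _ _|x y _ _]; first by rewrite linearPl.
by rewrite hermC expr0 mul1r.
Qed.

Definition rip x y : R := complex.Re '[x, y].
Definition hn x : R := fnorm inner_form x.

Lemma inner_pos x : fdom inner_form x -> 0 <= rform inner_form x x.
Proof. by move=> _; rewrite -ler0c -ge0_RRe /= inner_norm exprn_ge0. Qed.

Lemma hn_ge0 x : 0 <= hn x. Proof. exact: fnorm_ge0. Qed.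
Lemma hn_sqr x : hn x ^+ 2 = rip x x.
Proof. exact: (fnorm_sqr inner_pos). Qed.

Lemma normE x : `|x| = (hn x)%:C.
Proof.
apply/eqP; rewrite -(eqrXn2 (n := 2))// ?normr_ge0// ?ler0c ?hn_ge0//.
rewrite -inner_norm -rmorphXn/= hn_sqr /rip -ge0_RRe//.
Qed.

Lemma rip_CS x y : `|rip x y| <= hn x * hn y.
Proof. exact: (rform_CS inner_sym inner_pos). Qed.
Lemma hnD x y : hn (x + y) <= hn x + hn y.
Proof. exact: (fnormD inner_sym inner_pos). Qed.
Lemma hnN x : hn (- x) = hn x.
Proof. exact: (fnormN inner_sym inner_pos). Qed.
Lemma hnBC x y : hn (x - y) = hn (y - x).
Proof. exact: (fnormBC inner_sym inner_pos). Qed.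
Lemma hnZ c x : hn (c *: x) = Normc.normc c * hn x.
Proof. exact: (fnormZ inner_sym inner_pos). Qed.
Lemma hn0 : hn 0 = 0.
Proof. exact: (fnorm0 inner_sym inner_pos). Qed.
Lemma hn_distD y x z : hn (x - z) <= hn (x - y) + hn (y - z).
Proof. exact: (fnorm_distD inner_sym inner_pos). Qed.
Lemma hn_eq0 x : hn x = 0 -> x = 0.
Proof. by move=> h; apply/eqP; rewrite -normr_eq0 normE h. Qed.
Lemma ripC x y : rip x y = rip y x.
Proof. exact: (rformC inner_sym). Qed.
Lemma ripDl x y w : rip (x + y) w = rip x w + rip y w.
Proof. exact: (rformDl inner_sym). Qed.
Lemma ripBl x y w : rip (x - y) w = rip x w - rip y w.
Proof. exact: (rformBl inner_sym). Qed.
Lemma ripZl t x w : rip (t%:C *: x) w = t * rip x w.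
Proof. exact: (rformZl inner_sym). Qed.
Lemma ripNl x w : rip (- x) w = - rip x w.
Proof. by rewrite -[- x]add0r ripBl (_ : rip 0 w = 0) ?add0r// -(scale0r 0) ripZl mul0r. Qed.
Lemma innerxx x : '[x, x] = (hn x ^+ 2)%:C.
Proof. exact: (fformxx inner_sym inner_pos). Qed.
Lemma inner_conj x y : '[y, x] = conjC '[x, y].
Proof. exact: (fform_conj inner_sym). Qed.
Lemma hn_quad (t : R) x y : hn (x + t%:C *: y) ^+ 2 =
  hn x ^+ 2 + 2 * t * rip x y + t ^+ 2 * hn y ^+ 2.
Proof. by rewrite !hn_sqr; exact: (rform_quad inner_sym). Qed.

End HilbertNorm.
#[global] Hint Resolve hn_ge0 fnorm_ge0 : core.

Lemma invn_small (R : realType) (e : R) : 0 < e ->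
  exists n0, forall n, (n0 <= n)%N -> n.+1%:R^-1 <= e.
Proof.
move=> e0; exists (Num.truncn e^-1) => n hn.
rewrite invf_ple ?posrE// ltW//.
rewrite (lt_le_trans (truncnS_gt _))// ler_nat ltnS//.
Qed.

(** Limit passages below end with this lemma; [c] collects the constants of an estimate, and its
    sign need not be checked. *)
Lemma le_eps0 (R : realType) (x c : R) :
  (forall e, 0 < e -> `|x| <= c * e) -> x = 0.
Proof.
move=> h; apply/eqP; rewrite -normr_le0; apply/ler_addgt0Pr => e e0.
rewrite add0r; have c0 : 0 < `|c| + 1 by rewrite ltr_wpDl.
have := h (e / (`|c| + 1)) (divr_gt0 e0 c0) => /le_trans; apply.
rewrite mulrCA -[leRHS]mulr1 ler_pM2l// ler_pdivrMr// mul1r.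
by rewrite (le_trans (ler_norm c))// lerDl.
Qed.

Section HilbertTopology.
Variables (R : realType) (H : hilbertType R).

Lemma hn_lt (x : H) (e : R) : (`|x| < e%:C) = (hn x < e).
Proof. by rewrite normE ltcR. Qed.

Lemma ball_hn (x y : H) (e : R) : ball x e%:C y = (hn (x - y) < e) :> Prop.
Proof. by rewrite -ball_normE /= hn_lt. Qed.

Lemma hn_cvgP (u : nat -> H) (x : H) : (u @ \oo --> x) <->
  (forall e : R, 0 < e -> exists n0, forall n, (n0 <= n)%N -> hn (u n - x) <= e).
Proof.
split=> [/cvgrPdist_le h e e0|h].
  have : 0 < e%:C by rewrite ltr0c.
  move=> /h [n0 _ hn0]; exists n0 => n /hn0 /=.
  by rewrite normE lecR hnBC.
apply/cvgrPdist_le => e /gt0_RRe [t t0 ->].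
have [n0 hn0] := h t t0; exists n0 => // n /= /hn0.
by rewrite normE lecR hnBC.
Qed.

Lemma hn_complete (u : nat -> H) :
  (forall e : R, 0 < e -> exists n0, forall m n, (n0 <= m)%N -> (n0 <= n)%N ->
     hn (u m - u n) <= e) ->
  exists x : H, u @ \oo --> x.
Proof.
move=> h; suff : cvgn u by move=> /cvg_ex.
apply/cauchy_cvgP/cauchy_ballP => e /gt0_RRe [t t0 ->]; near_simpl.
have t20 : 0 < t / 2 by rewrite divr_gt0.
have [n0 hn0] := h _ t20.
exists ([set n | (n0 <= n)%N], [set n | (n0 <= n)%N]); first by split; exists n0.
move=> [m n] [/= hm hn1]; rewrite ball_hn (le_lt_trans (hn0 _ _ hm hn1))//.
by rewrite ltr_pdivrMr// ltr_pMr// ltr1n.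
Qed.

End HilbertTopology.

Section HilbertClosure.
Variables (R : realType) (H K : hilbertType R).

Lemma closureP_pair (S : set (H * K)) x y : closure S (x, y) <->
  forall e : R, 0 < e -> exists x' y', [/\ S (x', y'), hn (x - x') < e & hn (y - y') < e].
Proof.
split=> [h e e0|h B].
  have e0' : 0 < e%:C by rewrite ltr0c.
  have [[x' y'] [Sxy [/= bx by_]]] := h _ (nbhsx_ballx (x, y) _ e0').
  by exists x', y'; split=> //; rewrite -ball_hn.
move=> /nbhs_ballP[e /gt0_RRe [t t0 ->]] eB.
have [x' [y' [Sxy hx hy]]] := h t t0.
by exists (x', y'); split => //; apply: eB; split; rewrite /= ball_hn.
Qed.

Lemma closureP_quad (S : set ((H * K) * (H * K))) x y f g : closure S ((x, y), (f, g)) <->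
  forall e : R, 0 < e -> exists x' y' f' g', [/\ S ((x', y'), (f', g')),
    hn (x - x') < e, hn (y - y') < e, hn (f - f') < e & hn (g - g') < e].
Proof.
split=> [h e e0|h B].
  have e0' : 0 < e%:C by rewrite ltr0c.
  have [[[x' y'] [f' g']] [Sxy [[/= bx by_] [/= bf bg]]]] :=
    h _ (nbhsx_ballx ((x, y), (f, g)) _ e0').
  by exists x', y', f', g'; split=> //; rewrite -ball_hn.
move=> /nbhs_ballP[e /gt0_RRe [t t0 ->]] eB.
have [x' [y' [f' [g' [Sxy hx hy hf hg]]]]] := h t t0.
by exists ((x', y'), (f', g')); split => //; apply: eB; split; split; rewrite /= ball_hn.
Qed.

Lemma denseP (S : set H) x (e : R) : dense S -> 0 < e -> exists2 x', S x' & hn (x - x') < e.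
Proof.
move=> dS e0; have e0' : 0 < e%:C by rewrite ltr0c.
have [||x' [/= bx Sx]] := dS (ball x e%:C); last 1 first.
- by exists x' => //; rewrite -ball_hn.
- by exists x; exact: ballxx.
- exact: ball_open.
Qed.

End HilbertClosure.

(** * Coercive closed forms: completeness and Riesz representation *)

Section ClosedForm.
Variables (R : realType) (H : hilbertType R) (f : sesq H).
Hypotheses (f_sym : symmetric_sesq f) (f_closed : form_closed f).
Hypothesis f_coer : forall x, fdom f x -> hn x ^+ 2 <= rform f x x.

Local Notation N := (fnorm f).

Lemma coercive_pos x : fdom f x -> 0 <= rform f x x.
Proof. by move=> /f_coer; apply: le_trans; exact: sqr_ge0. Qed.

Lemma hn_le_fnorm x : fdom f x -> hn x <= N x.
Proof.
move=> fx; rewrite -(ler_pXn2r (n := 2))// ?nnegrE ?hn_ge0 ?fnorm_ge0//.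
by rewrite (fnorm_sqr coercive_pos)// f_coer.
Qed.

(** By coercivity a form-Cauchy sequence is Cauchy in [H]; closedness then puts its limit into the
    domain and upgrades the convergence. *)
Lemma form_complete (u : nat -> H) : (forall n, fdom f (u n)) ->
  (forall e : R, 0 < e -> exists n0, forall m n, (n0 <= m)%N -> (n0 <= n)%N ->
     N (u m - u n) <= e) ->
  exists2 x, fdom f x &
    forall e : R, 0 < e -> exists n0, forall n, (n0 <= n)%N -> N (u n - x) <= e.
Proof.
move=> fu hN.
have [x ux] : exists x : H, u @ \oo --> x.
  apply: hn_complete => e /hN [n0 hn0]; exists n0 => m n hm hn1.
  exact: le_trans (hn_le_fnorm (fdomB f_sym (fu _) (fu _))) (hn0 _ _ hm hn1).
have [|fx hx] := f_closed fu ux.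
  move=> e e0; have s0 : 0 < Num.sqrt e / 2 by rewrite divr_gt0// sqrtr_gt0.
  have [n0 hn0] := hN _ s0.
  exists ([set n | (n0 <= n)%N], [set n | (n0 <= n)%N]); first by split; exists n0.
  move=> [m n] [/= hm hn1]; have fd := fdomB f_sym (fu m) (fu n).
  rewrite (fformxx f_sym coercive_pos)// ger0_norm ?ler0c ?sqr_ge0// ltcR.
  rewrite -[ltRHS](sqr_sqrtr (ltW e0)) ltr_pXn2r ?nnegrE ?sqrtr_ge0//.
  rewrite (le_lt_trans (hn0 _ _ hm hn1))// ltr_pdivrMr// ltr_pMr ?ltr1n//.
  by rewrite sqrtr_gt0.
exists x => // e e0; have [|n0 _ hn0] := hx (e ^+ 2); first by rewrite exprn_gt0.
exists n0 => n /hn0 /=; have fd := fdomB f_sym (fu n) fx.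
rewrite (fformxx f_sym coercive_pos)// ger0_norm ?ler0c ?sqr_ge0// ltcR => /ltW.
by rewrite ler_pXn2r ?nnegrE ?hn_ge0 ?fnorm_ge0// ltW.
Qed.

(** Direct method: the representing vector minimises [J], and a minimising sequence is form-Cauchy.
    The functional is real-linear; complex equations are reached later through [form_eqP]. *)
Lemma form_riesz (l : H -> R) (C : R) :
  (forall x y, fdom f x -> fdom f y -> l (x + y) = l x + l y) ->
  (forall (t : R) x, fdom f x -> l (t%:C *: x) = t * l x) ->
  (forall x, fdom f x -> `|l x| <= C * N x) ->
  exists2 x, fdom f x & forall w, fdom f w -> rform f x w = l w.
Proof.
move=> lD lZ lC; pose J x := rform f x x - 2 * l x.
pose E := [set J x | x in fdom f].
have E_inf : has_inf E.
  split; first by exists (J 0), 0 => //; exact: fdom0.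
  exists (- C ^+ 2) => _ [x fx <-]; rewrite /J -(fnorm_sqr coercive_pos)//.
  have := lC _ fx; rewrite ler_norml => /andP[_].
  have := sqr_ge0 (N x - C); nra.
have [u hu] : {u : nat -> H & forall n, fdom f (u n) /\ J (u n) < inf E + n.+1%:R^-1}.
  apply: (@choice _ _ (fun n x => fdom f x /\ J x < inf E + n.+1%:R^-1)) => n.
  have [|_ [x fx <-] hx] := @inf_adherent _ E n.+1%:R^-1 _ E_inf; first by rewrite invr_gt0.
  by exists x.
have fu n : fdom f (u n) by case: (hu n).
have JE x : fdom f x -> inf E <= J x by move=> fx; apply: ge_inf E_inf.2 _ _; exists x.
(* [J (u n + t w)] is at least the infimum for every [t], while [J (u n)] exceeds it by less than
   [1 / (n + 1)]: a quadratic polynomial in [t] is nonnegative. *)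
have quad n w : fdom f w -> (rform f (u n) w - l w) ^+ 2 <= n.+1%:R^-1 * rform f w w.
  move=> fw; apply: quad_discr => t.
  have ftw := fdomZ f_sym t%:C fw.
  have := JE _ (fdomD f_sym (fu n) ftw); have [_] := hu n.
  rewrite /J (rform_quad f_sym)// lD// lZ//; move: (n.+1%:R^-1) => r; lra.
have small n w : fdom f w -> `|rform f (u n) w - l w| <= Num.sqrt n.+1%:R^-1 * N w.
  move=> fw; rewrite -(ler_pXn2r (n := 2))// ?nnegrE ?mulr_ge0 ?sqrtr_ge0 ?fnorm_ge0//.
  by rewrite real_normK ?num_real// exprMn (fnorm_sqr coercive_pos)// sqr_sqrtr ?invr_ge0// quad.
have small_ev e : 0 < e -> exists n0, forall n, (n0 <= n)%N ->
    forall w, fdom f w -> `|rform f (u n) w - l w| <= e * N w.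
  move=> e0; have [|n0 hn0] := @invn_small _ (e ^+ 2); first by rewrite exprn_gt0.
  exists n0 => n /hn0 hn1 w fw; apply: le_trans (small n w fw) _.
  rewrite ler_wpM2r ?fnorm_ge0//; rewrite -[leRHS](ger0_norm (ltW e0)) -sqrtr_sqr ler_sqrt//.
  by rewrite exprn_ge0// ltW.
have [x fx ux] : exists2 x, fdom f x &
    forall e : R, 0 < e -> exists n0, forall n, (n0 <= n)%N -> N (u n - x) <= e.
  apply: form_complete => // e e0.
  have [|n0 hn0] := small_ev (e / 2); first by rewrite divr_gt0.
  exists n0 => m n hm hn1; have fd := fdomB f_sym (fu m) (fu n).
  have := hn0 _ hm _ fd; have := hn0 _ hn1 _ fd.
  rewrite !ler_norml => /andP[h1 h2] /andP[h3 h4].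
  (* The approximate equations of [u m] and [u n] are subtracted and tested with the difference
     itself. *)
  have h5 : N (u m - u n) ^+ 2 <= e * N (u m - u n).
    by rewrite (fnorm_sqr coercive_pos)// {1}/rform -/(rform f _ _) (rformBl f_sym)//; lra.
  have := fnorm_ge0 f (u m - u n); nra.
exists x => // w fw; apply/eqP; rewrite -subr_eq0; apply/eqP.
apply: (@le_eps0 _ _ (2 * N w)) => e e0.
have [n0 hn0] := small_ev _ e0; have [n1 hn1] := ux _ e0.
have := hn0 _ (leq_maxl n0 n1) _ fw; have := hn1 _ (leq_maxr n0 n1).
move: (maxn _ _) => n; have fd := fdomB f_sym (fu n) fx.
have := rform_CS f_sym coercive_pos fd fw; rewrite (rformBl f_sym)//.
rewrite !ler_norml => /andP[? ?] ? /andP[? ?].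
have : N (u n - x) * N w <= e * N w by rewrite ler_wpM2r ?fnorm_ge0.
by move=> ?; apply/andP; split; lra.
Qed.

End ClosedForm.

(** * Adjoints and their boundedness for a form norm *)

Section Adjoint.
Variables (R : realType) (H K : hilbertType R) (T : operator H K).

Lemma adjoint_single : densely_defined T -> single_valued (adjoint T).
Proof.
move=> dT x y y' h h'; apply/eqP; rewrite -subr_eq0; apply/eqP; apply: hn_eq0.
apply: (@le_eps0 _ _ 1) => e e0; rewrite mul1r.
have [u [v Tuv] hu] := denseP (y - y') dT e0.
have ur : rip u (y - y') = 0.
  by rewrite /rip linearBr/= -(h _ _ Tuv) -(h' _ _ Tuv) subrr.
have := rip_CS (y - y' - u) (y - y').
rewrite ripBl ur subr0 -hn_sqr ler_norml => /andP[_].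
rewrite ger0_norm ?hn_ge0//.
have := hn_ge0 (y - y'); have := hn_ge0 (y - y' - u); nra.
Qed.

Lemma adjoint_linear c x y x' y' :
  adjoint T (x, y) -> adjoint T (x', y') -> adjoint T (c *: x + x', c *: y + y').
Proof.
move=> h h' u v Tuv /=; rewrite !linearPr/=.
by rewrite (h _ _ Tuv) (h' _ _ Tuv).
Qed.

(** A vector of the domain within [hn y / 4] of [y] is normalised: its norm is at most 5/4 of
    [hn y], its product with [y] at least 3/4 of the square, and the quotient 3/5 exceeds 1/2. *)
Lemma dense_align (y : H) : linear_operator T -> densely_defined T ->
  exists u v, [/\ T (u, v), hn u <= 1 & hn y <= 2 * rip u y].
Proof.
move=> [T0 TZD _] dT; have [->|y0] := eqVneq y 0.
  by exists 0, 0; rewrite !hn0 /rip linear0r mulr0 ler01.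
have hy : 0 < hn y by rewrite lt_neqAle hn_ge0 andbT eq_sym; apply: contraNneq y0 => /hn_eq0 ->.
have [u [v Tuv] hu] : exists2 u, dom T u & hn (y - u) < hn y / 4.
  by apply: denseP => //; rewrite divr_gt0.
have u1 : hn u <= 5 / 4 * hn y.
  have := hnD y (- (y - u)); rewrite hnN subKr; lra.
have u2 : 3 / 4 * hn y ^+ 2 <= rip u y.
  have := rip_CS (y - u) y; rewrite ler_norml ripBl -hn_sqr => /andP[_].
  nra.
have u3 : 0 < hn u.
  rewrite lt_neqAle hn_ge0 andbT eq_sym; apply/eqP => /hn_eq0 u0.
  move: u2; rewrite u0 /rip linear0l; nra.
exists ((hn u)^-1%:C *: u), ((hn u)^-1%:C *: v); split.
- by have := TZD (hn u)^-1%:C _ 0 Tuv T0; rewrite addr0.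
- by rewrite hnZ/= expr0n addr0 sqrtr_sqr ger0_norm ?invr_ge0 ?hn_ge0// mulVf// gt_eqF.
- rewrite ripZl mulrCA ler_pdivlMl//; nra.
Qed.

End Adjoint.

Section AdjointBound.
Variables (R : realType) (H K : hilbertType R) (f : sesq H) (B : operator K H).
Hypotheses (f_sym : symmetric_sesq f) (f_closed : form_closed f).
Hypothesis f_coer : forall x, fdom f x -> hn x ^+ 2 <= rform f x x.
Hypotheses (B_lin : linear_operator B) (B_dense : densely_defined B).
Hypothesis f_adj : fdom f `<=` dom (adjoint B).

Local Notation N := (fnorm f).
Let f_pos := coercive_pos f_coer.

(** One hump. A large value of the adjoint at some [w] yields, through [B] on the unit ball, a
    vector [v] whose functional becomes large after a displacement along [w]. The new radius [e'] is
    fixed after [v], so that it can be small relative to [hn v]. *)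
Lemma gliding_hump_step :
  (forall C : R, exists x v, [/\ fdom f x, adjoint B (x, v) & C * N x < hn v]) ->
  forall (n : nat) (x : H) (e : R), fdom f x -> 0 < e ->
  exists x' e' u v, [/\ fdom f x' /\ N (x' - x) <= e / 2, 0 < e' <= e / 2,
    B (u, v) /\ hn u <= 1, n%:R <= `|rip v x'| & e' * hn v <= 1].
Proof.
move=> unbdd n x e fx e0.
(* The factor pays for scaling [w] to form norm [e / 2] and for the 2 lost in [dense_align]. *)
have [w [b [fw wb hb]]] := unbdd (4 * n%:R / e).
have w0 : 0 < N w.
  rewrite lt_neqAle fnorm_ge0 andbT eq_sym; apply/eqP => Nw.
  have := hn_le_fnorm f_coer fw; rewrite Nw => hw.
  have w0 : w = 0 by apply: hn_eq0; apply/eqP; rewrite eq_le hw hn_ge0.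
  have b0 : b = 0.
    apply: (adjoint_single B_dense wb); rewrite w0 => u v _ /=.
    by rewrite !linear0r.
  by move: hb; rewrite Nw b0 hn0 mulr0 ltxx.
have [u [v [Buv u1 ub]]] := dense_align b B_lin B_dense.
have vw : rip v w = rip u b by rewrite /rip (wb _ _ Buv).
pose t := e / 2 / N w.
have t0 : 0 < t by rewrite !divr_gt0.
pose s := t%:C *: w.
have fs : fdom f s by exact: fdomZ.
have Ns : N s = e / 2.
  rewrite (fnormZ f_sym f_pos)//= expr0n addr0 sqrtr_sqr gtr0_norm//.
  by rewrite /t divfK// gt_eqF.
have vs : n%:R <= rip v s.
  rewrite ripC ripZl ripC vw.
  have -> : n%:R = t * (2 * n%:R / e * N w) :> R by rewrite /t; field; rewrite !gt_eqF.
  rewrite ler_pM2l//; rewrite (_ : 2 * _ / e * _ = 4 * n%:R / e * N w / 2); last by field; rewrite gt_eqF.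
  by rewrite ler_pdivrMr// [leRHS]mulrC (le_trans (ltW hb)).
have v1 : 0 < 1 + hn v by rewrite ltr_pwDl ?hn_ge0.
(* The values of [rip v] at [x + s] and [x - s] differ by at least [2 n], so one of them has modulus
   at least [n]. *)
have [x' [fx' Nx' vx']] : exists x', [/\ fdom f x', N (x' - x) <= e / 2 & n%:R <= `|rip v x'|].
  have [h|h] := lerP n%:R `|rip v (x + s)|.
    by exists (x + s); rewrite addrAC subrr add0r Ns; split => //; exact: fdomD.
  exists (x - s); rewrite addrAC subrr add0r fnormN// Ns; split => //; first exact: fdomB.
  move: h; rewrite !(ripC v) ripDl ripBl !(ripC _ v) ltr_norml => /andP[h1 h2].
  rewrite -normrN; apply: le_trans (ler_norm _); lra.
exists x', (Num.min (e / 2) (1 + hn v)^-1), u, v; split => //.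
  by rewrite lt_min divr_gt0// invr_gt0 v1/= ge_min lexx.
rewrite (@le_trans _ _ ((1 + hn v)^-1 * hn v))//.
  by rewrite ler_wpM2r ?hn_ge0// ge_min lexx orbT.
by rewrite mulrC ler_pdivrMr// mul1r lerDr.
Qed.

(** Otherwise the humps converge in form norm to some [x] of the domain. There the adjoint has a
    value [b], and moving [B] across keeps the chosen functionals at [x] bounded by [hn b], whereas
    the humps make them grow like [n]. *)
Lemma adjoint_form_bounded :
  exists C : R, forall x v, fdom f x -> adjoint B (x, v) -> hn v <= C * N x.
Proof.
apply: contrapT => hC.
have /gliding_hump_step step : forall C : R,
    exists x v, [/\ fdom f x, adjoint B (x, v) & C * N x < hn v].
  move=> C; apply: contrapT => h; apply: hC; exists C => x v fx xv.
  by rewrite leNgt; apply/negP => h'; apply: h; exists x, v.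
pose good (n : nat) (p q : H * R) (r : K * H) :=
  [/\ fdom f q.1 /\ N (q.1 - p.1) <= p.2 / 2, 0 < q.2 <= p.2 / 2,
    B r /\ hn r.1 <= 1, n%:R <= `|rip r.2 q.1| & q.2 * hn r.2 <= 1].
have [F hF] : {F : nat * (H * R) -> (H * R) * (K * H) &
    forall np, fdom f np.2.1 -> 0 < np.2.2 -> good np.1 np.2 (F np).1 (F np).2}.
  (* Choice needs a total relation; for inadmissible pairs the implication is vacuous and zeros are
     returned. *)
  apply: (@choice _ _ (fun np qr => fdom f np.2.1 -> 0 < np.2.2 -> good np.1 np.2 qr.1 qr.2)).
  move=> [n [x e]] /=.
  have [[fx e0]|h] := pselect (fdom f x /\ 0 < e); last by exists ((0, 0), (0, 0)) => fx e0; case: h.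
  have [x' [e' [u [v h]]]] := step n x e fx e0.
  by exists ((x', e'), (u, v)).
(* The radius [(s n).2] bounds all later displacements, which therefore change the
   functional [rip (r n).2] chosen at step [n] by at most 1. *)
pose s := fix s n := if n is m.+1 then (F (m, s m)).1 else (0 : H, 1 : R).
pose r n := (F (n, s n)).2.
have s_ok n : fdom f (s n).1 /\ 0 < (s n).2.
  elim: n => [|n [fs es]]; first by split; [exact: fdom0|exact: ltr01].
  by have [[? _] /andP[? _] _ _ _] := hF (n, s n) fs es.
have good_s n : good n (s n) (s n.+1) (r n) by case: (s_ok n); exact: (hF (n, s n)).
(* A displacement is at most half the current radius, hence at most the loss of radius in that step,
   and these losses telescope. *)
have dist n k : N ((s (n + k)%N).1 - (s n).1) <= (s n).2 - (s (n + k)%N).2.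
  elim: k => [|k ih]; first by rewrite addn0 !subrr (fnorm0 f_sym f_pos).
  have [f1 _] := s_ok n; have [f2 _] := s_ok (n + k)%N; have [f3 _] := s_ok (n + k).+1.
  rewrite addnS; apply: le_trans (fnorm_distD f_sym f_pos f3 f2 f1) _.
  have [[_ h1] /andP[_ h2] _ _ _] := good_s (n + k)%N; lra.
have half n : (s n).2 <= n.+1%:R^-1.
  elim: n => [|n ih]; first by rewrite invr1.
  have [_ /andP[_ h] _ _ _] := good_s n; apply: le_trans h _.
  rewrite ler_pdivrMr// (le_trans ih)// ler_pdivlMl// mulrC -ler_pdivlMl ?invr_gt0// invrK mulrC.
  by rewrite -natrM ler_nat ltn_Pmull.
have [|x fx sx] := @form_complete _ _ _ f_sym f_closed f_coer (fun n => (s n).1) (fun n => (s_ok n).1).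
  move=> e e0; have [|n0 hn0] := @invn_small _ (e / 2); first by rewrite divr_gt0.
  have tail m : (n0 <= m)%N -> N ((s m).1 - (s n0).1) <= e / 2.
    move=> nm; have := dist n0 (m - n0)%N; rewrite subnKC// => h.
    apply: le_trans h _; have := le_trans (half n0) (hn0 _ (leqnn _)); have [_] := s_ok m; lra.
  exists n0 => m n hm hn1; have [f1 _] := s_ok m; have [f2 _] := s_ok n; have [f3 _] := s_ok n0.
  apply: le_trans (fnorm_distD f_sym f_pos f1 f3 f2) _.
  have := tail _ hm; have := tail _ hn1; rewrite (fnormBC f_sym f_pos f2 f3); lra.
have [b xb] := f_adj fx.
have lim n : N (x - (s n).1) <= (s n).2.
  apply/ler_addgt0Pr => e e0; have [n0 hn0] := sx _ e0.
  have [f1 _] := s_ok n; have [f2 p2] := s_ok (n + n0)%N.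
  apply: le_trans (fnorm_distD f_sym f_pos fx f2 f1) _.
  have := hn0 (n + n0)%N (leq_addl _ _); have := dist n n0.
  rewrite (fnormBC f_sym f_pos f2 fx); lra.
have small n : n%:R <= hn b + 1.
  have [_ _ [Br r1] h1 h2] := good_s n.
  have [f1 _] := s_ok n.+1.
  have h3 : hn (x - (s n.+1).1) <= (s n.+1).2.
    by apply: le_trans (lim _); exact: hn_le_fnorm (fdomB f_sym fx f1).
  have h4 := rip_CS (r n).2 (x - (s n.+1).1).
  have h5 : rip (r n).2 x = rip (r n).1 b by rewrite /rip (xb (r n).1)//; case: (r n) Br.
  have h6 := rip_CS (r n).1 b.
  have h7 : hn (r n).1 * hn b <= hn b by rewrite ler_piMl ?hn_ge0.
  have h8 : hn (r n).2 * hn (x - (s n.+1).1) <= 1.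
    by apply: le_trans h2; rewrite mulrC ler_wpM2r ?hn_ge0.
  move: h1 h4 h6 {h2}; rewrite (ripC _ (x - _)) ripBl !(ripC _ (r n).2) h5 => h1 h4 h6.
  have := ler_normB (rip (r n).1 b) (rip (r n).1 b - rip (r n).2 (s n.+1).1).
  by rewrite subKr => *; lra.
have := small (Num.truncn (hn b + 1)).+1; rewrite leNgt => /negP; apply.
exact: truncnS_gt.
Qed.

End AdjointBound.

(** * Resolvents and the distance to the spectrum *)

Section Resolvent.
Variables (R : realType) (H : hilbertType R) (T : operator H H).

Definition resol (z : R[i]) (y : H) : H := app (inv_op (shift_op T z)) y.

Lemma resolP z y : resolvent_set T z -> T (resol z y, y + z *: resol z y).
Proof.
move=> [/(_ y)[x [Tx _]] _].
exact: (@xgetPex _ 0 [set x | shift_op T z (x, y)] (ex_intro _ x Tx)).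
Qed.

Lemma resol_uniq z x y : resolvent_set T z -> T (x, y + z *: x) -> x = resol z y.
Proof.
move=> zT Txy; have [/(_ y)[x' [_ x'u]] _] := zT.
by rewrite -(x'u x Txy) -(x'u (resol z y) (resolP y zT)).
Qed.

Lemma resolvent_lower z : resolvent_set T z ->
  exists2 c : R, 0 < c & forall x y, T (x, y) -> hn x <= c * hn (y - z *: x).
Proof.
move=> [_ [c hc]]; exists (`|c| + 1); first by rewrite ltr_wpDl.
move=> x y Txy; have := hc x (y - z *: x); rewrite /shift_op/= subrK => /(_ Txy).
rewrite !normE -rmorphM/= lecR => /le_trans; apply.
by rewrite ler_wpM2r ?hn_ge0// (le_trans (ler_norm _))// lerDl.
Qed.

Hypothesis T_lin : linear_operator T.

Lemma opZD c x y x' y' : T (x, y) -> T (x', y') -> T (c *: x + x', c *: y + y').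
Proof. by case: T_lin => _ h _ h1 h2; exact: (h c _ _ h1 h2). Qed.

Lemma opZ c x y : T (x, y) -> T (c *: x, c *: y).
Proof. by case: T_lin => T0 _ _ h; have := opZD c h T0; rewrite !addr0. Qed.

Lemma opB x y x' y' : T (x, y) -> T (x', y') -> T (x - x', y - y').
Proof.
by move=> h h'; have := opZD (-1) h' h; rewrite !scaleN1r addrC [- y' + _]addrC.
Qed.

Lemma resolZD z c x y : resolvent_set T z ->
  resol z (c *: x + y) = c *: resol z x + resol z y.
Proof.
move=> zT; apply/esym; apply: resol_uniq => //.
have := opZD c (resolP x zT) (resolP y zT).
by rewrite !scalerDr !scalerA [c * z]mulrC addrACA.
Qed.

End Resolvent.

Section SymmetricBound.
Variables (R : realType) (H : hilbertType R) (T : operator H H).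
Hypothesis T_sa : self_adjoint T.

Let T_lin : linear_operator T. Proof. by case: T_sa. Qed.

Lemma sa_sym u v x y : T (u, v) -> T (x, y) -> '[v, x] = '[u, y].
Proof. by case: T_sa => _ _ aT Tuv; rewrite -{1}aT; apply. Qed.

Lemma resol_sym (m : R) u v : resolvent_set T m%:C ->
  rip (resol T m%:C u) v = rip u (resol T m%:C v).
Proof.
move=> mT; have := congr1 (@complex.Re R) (sa_sym (resolP u mT) (resolP v mT)).
rewrite -/(rip _ _) -/(rip _ _) ripDl ripZl (ripC _ (v + _)) ripDl ripZl (ripC v).
rewrite (ripC (resol T m%:C v)); lra.
Qed.

(** Let [S] be the norm of the resolvent at [m] and suppose [1 < d * S]. With [q = 1 / S], both
    [m + q] and [m - q] are resolvent points, so [(T - m)^2 - q^2] is bounded below. But if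
    [hn (r v)] is close to [S] with [hn v <= 1], then [v - q^2 r (r v)] is small while [r (r v)] is
    not. *)
Lemma sa_gap (m d : R) : 0 < d ->
  (forall l, `|l - m| < d -> resolvent_set T l%:C) ->
  forall x y, T (x, y) -> d * hn x <= hn (y - m%:C *: x).
Proof.
move=> d0 hT.
have mT : resolvent_set T m%:C by apply: hT; rewrite subrr normr0.
pose r := resol T m%:C; pose E := [set hn (r v) | v in [set v | hn v <= 1]].
have [c c0 hc] := resolvent_lower mT.
have rT v : T (r v, v + m%:C *: r v) by exact: resolP.
have E_sup : has_sup E.
  split; first by exists (hn (r 0)), 0 => //=; rewrite hn0 ler01.
  exists c => _ [v v1 <-]; have := hc _ _ (rT v); rewrite addrK => /le_trans; apply.
  by rewrite ler_piMr// ltW.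
pose S := sup E.
have rS v : hn (r v) <= S * hn v.
  have [v0|v0] := eqVneq (hn v) 0.
    by have := hc _ _ (rT v); rewrite addrK v0 !mulr0.
  have {}v0 : 0 < hn v by rewrite lt_neqAle eq_sym v0 hn_ge0.
  have : hn (r ((hn v)^-1%:C *: v)) <= S.
    apply: ub_le_sup E_sup.2 _ _; exists ((hn v)^-1%:C *: v) => //=.
    by rewrite hnZ/= expr0n addr0 sqrtr_sqr ger0_norm ?invr_ge0 ?hn_ge0// mulVf// gt_eqF.
  have -> : r ((hn v)^-1%:C *: v) = (hn v)^-1%:C *: r v.
    by apply/esym/resol_uniq => //; rewrite scalerA mulrC -scalerA -scalerDr; apply: opZ.
  by rewrite hnZ/= expr0n addr0 sqrtr_sqr ger0_norm ?invr_ge0 ?hn_ge0// ler_pdivrMl// mulrC.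
have S0 : 0 <= S by rewrite (le_trans (hn_ge0 (r 0)))// ub_le_sup//; [case: E_sup|exists 0 => //=; rewrite hn0 ler01].
suff dS : d * S <= 1.
  move=> x y Txy; have := rS (y - m%:C *: x).
  rewrite -(_ : x = r (y - m%:C *: x)); last by apply: resol_uniq => //; rewrite subrK.
  have := hn_ge0 (y - m%:C *: x); nra.
rewrite leNgt; apply/negP => dS.
have {S0}S0 : 0 < S by rewrite lt_neqAle S0 andbT; apply/eqP => S00; move: dS; rewrite -S00 mulr0 ltr10.
pose q := S^-1; have q0 : 0 < q by rewrite invr_gt0.
have qS : q * S = 1 by rewrite mulVf// gt_eqF.
have qd : q < d by rewrite -[q]mul1r ltr_pdivrMr.
have [|c1 c10 hc1] := @resolvent_lower _ _ T (m + q)%:C.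
  by apply: hT; rewrite addrAC subrr add0r gtr0_norm.
have [|c2 c20 hc2] := @resolvent_lower _ _ T (m - q)%:C.
  by apply: hT; rewrite addrAC subrr add0r normrN gtr0_norm.
pose k := c1 * c2; have k0 : 0 < k by rewrite mulr_gt0.
(* [(T - m)^2 - q^2 = (T - m - q) (T - m + q)] is bounded below. *)
have lower v : hn (r (r v)) <= k * hn (v - (q ^+ 2)%:C *: r (r v)).
  set u := r (r v); have Tu : T (u, r v + m%:C *: u) by exact: rT.
  have Tw := opB T_lin (rT v) (opZ T_lin q%:C Tu).
  have := hc1 _ _ Tu; have := hc2 _ _ Tw.
  rewrite (_ : r v + m%:C *: u - (m + q)%:C *: u = r v - q%:C *: u); last first.
    by rewrite rmorphD scalerDl opprD addrA addrK.
  rewrite (_ : v + _ - _ - _ = v - (q ^+ 2)%:C *: u); last first.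
    rewrite rmorphB rmorphXn/= scalerBl opprB.
    have -> : v + m%:C *: r v - q%:C *: (r v + m%:C *: u) =
        v - q%:C *: r v + m%:C *: (r v - q%:C *: u).
      by rewrite scalerDr scalerBr opprD !scalerA mulrC !addrA; congr (_ - _); rewrite addrAC.
    rewrite (addrC (q%:C *: _)) addrA addrK scalerBr addrA subrK scalerA.
    by rewrite -expr2.
  rewrite /k; have := hn_ge0 (v - (q ^+ 2)%:C *: u); nra.
(* Symmetry of the resolvent gives [rip v u = t^2]; this bounds [hn u] below by [t^2] and, with
   [q * hn u <= t], the square of [hn (v - q^2 u)] above by [1 - q^2 t^2]. *)
have key v : hn v <= 1 -> (hn (r v)) ^+ 4 <= k ^+ 2 * (1 - q ^+ 2 * hn (r v) ^+ 2).
  move=> v1; set t := hn (r v); set u := r (r v).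
  have vu : rip v u = t ^+ 2 by rewrite /u -resol_sym// -hn_sqr.
  have t2u : t ^+ 2 <= hn u.
    rewrite -vu; apply: le_trans (ler_norm _) _; apply: le_trans (rip_CS _ _) _.
    by rewrite ler_piMl ?hn_ge0.
  have h1 : hn (v - (q ^+ 2)%:C *: u) ^+ 2 <= 1 - q ^+ 2 * t ^+ 2.
    rewrite -scaleNr -rmorphN hn_quad vu.
    have h2 : hn u <= S * t by exact: rS.
    have h3 : q ^+ 2 * hn u <= q * t.
      rewrite expr2 -mulrA ler_pM2l//.
      have : q * hn u <= q * (S * t) by rewrite ler_pM2l.
      by rewrite mulrA qS mul1r.
    have h4 : (q ^+ 2 * hn u) ^+ 2 <= (q * t) ^+ 2.
      by rewrite ler_pXn2r ?nnegrE ?mulr_ge0 ?hn_ge0// ltW// mulr_gt0.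
    have h5 : hn v ^+ 2 <= 1 by rewrite expr_le1 ?hn_ge0.
    nra.
  have h6 := le_trans t2u (lower v).
  have h7 : (t ^+ 2) ^+ 2 <= (k * hn (v - (q ^+ 2)%:C *: u)) ^+ 2.
    by rewrite ler_pXn2r ?nnegrE ?sqr_ge0 ?mulr_ge0 ?hn_ge0// ltW.
  rewrite (_ : 4 = 2 * 2)%N// exprM; apply: le_trans h7 _.
  by rewrite exprMn ler_pM2l// exprn_gt0.
(* The first bound forces [t >= S / 2], so the left side of [key] is at least [S^4 / 16]; the second
   keeps its right side below [2 S^4 / 33], or equal to it. Any number above 32 would do for 33. *)
pose e := Num.min (S / 2) (S ^+ 3 / (33 * k ^+ 2 * q ^+ 2)).
have kq : 0 < k ^+ 2 * q ^+ 2 by rewrite mulr_gt0// exprn_gt0.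
have e0 : 0 < e by rewrite lt_min !divr_gt0// ?exprn_gt0// -mulrA mulr_gt0.
have [_ [v v1 <-] hv] := sup_adherent e0 E_sup.
have := key v v1; have hvS : hn (r v) <= S by apply: ub_le_sup E_sup.2 _ _; exists v.
move: (hn (r v)) hv hvS => t; rewrite -/S => hv hvS ht.
have e1 : e <= S / 2 by rewrite ge_min lexx.
have e2 : k ^+ 2 * q ^+ 2 * e <= S ^+ 3 / 33.
  have -> : S ^+ 3 / 33 = k ^+ 2 * q ^+ 2 * (S ^+ 3 / (33 * k ^+ 2 * q ^+ 2)).
    by field; rewrite !gt_eqF.
  by rewrite ler_pM2l// ge_min lexx orbT.
have t4 : (S / 2) ^+ 4 <= t ^+ 4 by rewrite ler_pXn2r ?nnegrE//; lra.
have st : S ^+ 2 - t ^+ 2 <= 2 * S * e by nra.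
have E1 : k ^+ 2 * (1 - q ^+ 2 * t ^+ 2) = k ^+ 2 * q ^+ 2 * (S ^+ 2 - t ^+ 2).
  by rewrite -[1](expr1n _ 2) -qS; ring.
have h8 : k ^+ 2 * q ^+ 2 * (S ^+ 2 - t ^+ 2) <= k ^+ 2 * q ^+ 2 * (2 * S * e).
  by rewrite ler_pM2l.
have h9 : 2 * S * (k ^+ 2 * q ^+ 2 * e) <= 2 * S * (S ^+ 3 / 33).
  by rewrite ler_pM2l// mulr_gt0.
have h10 : 0 < S ^+ 4 by rewrite exprn_gt0.
have h11 : (S / 2) ^+ 4 = S ^+ 4 / 16 by field.
have h12 : 2 * S * (S ^+ 3 / 33) = 2 * S ^+ 4 / 33 by field.
lra.
Qed.

(** For [z = m + i n], real points within [sqrt (d^2 - n^2)] of [m] are closer than [d] to [z],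
    hence resolvent points. [sa_gap] bounds the real part of the shift, and Pythagoras adds
    [n^2]. *)
Lemma sa_dist (z : R[i]) : 0 < dist z (spectrum T) ->
  resolvent_set T z /\
  forall x y, T (x, y) -> dist z (spectrum T) * hn x <= hn (y - z *: x).
Proof.
set d := dist _ _ => d0.
have hd w : Normc.normc (z - w) < d -> resolvent_set T w.
  move=> wd; apply: contrapT => wT; move: wd; rewrite ltNge => /negP; apply.
  apply: ge_inf; last by exists w.
  by exists 0 => _ [? _ <-]; case: (z - _) => ? ? /=; exact: sqrtr_ge0.
split; first by apply: hd; rewrite subrr Normc.normc0.
case: z @d d0 hd => m n d d0 hd x y Txy.
have pyth : hn (y - (m +i* n) *: x) ^+ 2 = hn (y - m%:C *: x) ^+ 2 + n ^+ 2 * hn x ^+ 2.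
  have -> : m +i* n = m%:C + n%:C * 'i by simpc.
  rewrite scalerDl -scalerA opprD addrA.
  have := hn_quad (- n) (y - m%:C *: x) ('i *: x); rewrite rmorphN scaleNr => ->.
  (* The cross term vanishes because ['[y, x]] is real for a symmetric operator. *)
  have -> : rip (y - m%:C *: x) ('i *: x) = 0.
    rewrite /rip linearZr_LR/= linearBl/= linearZl_LR/= innerxx.
    have := inner_conj x y; rewrite -(sa_sym Txy Txy).
    case: '[y, x] => p q [] /eqP.
    by rewrite -addr_eq0 -mulr2n mulrn_eq0/= => /eqP ->; simpc.
  rewrite mulr0 addr0 sqrrN hnZ /= expr0n expr1n add0r sqrtr1 mul1r//.
rewrite -(ler_pXn2r (n := 2))// ?nnegrE ?mulr_ge0 ?hn_ge0 ?(ltW d0)// pyth exprMn.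
have [dn|nd] := leP (d ^+ 2) (n ^+ 2).
  have := sqr_ge0 (hn (y - m%:C *: x)); have := sqr_ge0 (hn x); nra.
have dn0 : 0 < d ^+ 2 - n ^+ 2 by rewrite subr_gt0.
have := @sa_gap m (Num.sqrt (d ^+ 2 - n ^+ 2)) _ _ x y Txy.
rewrite sqrtr_gt0 => /(_ dn0) h.
have {}h : Num.sqrt (d ^+ 2 - n ^+ 2) * hn x <= hn (y - m%:C *: x).
  apply: h => l hl; apply: hd => /=; rewrite subr0.
  rewrite -[d]gtr0_norm// -sqrtr_sqr ltr_sqrt ?exprn_gt0// -ltrBrDr.
  rewrite -normrN opprB -(ltr_pXn2r (n := 2)) ?nnegrE ?sqrtr_ge0// in hl.
  by rewrite real_normK ?num_real// sqr_sqrtr ?ltW// in hl.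
have : (Num.sqrt (d ^+ 2 - n ^+ 2) * hn x) ^+ 2 <= hn (y - m%:C *: x) ^+ 2.
  by rewrite ler_pXn2r// ?nnegrE ?mulr_ge0 ?sqrtr_ge0 ?hn_ge0.
by rewrite exprMn sqr_sqrtr ?(ltW dn0)// mulrBl lerBlDr.
Qed.

End SymmetricBound.

Lemma contraction_fixpoint (R : realType) (H : hilbertType R) (q : R) (phi : H -> H) :
  0 <= q < 1 -> (forall x y, hn (phi x - phi y) <= q * hn (x - y)) ->
  exists x, x = phi x.
Proof.
move=> /andP[q0 q1] h; pose u n := iter n phi 0.
have hu n : hn (u n - u n.+1) <= q ^+ n * hn (u 0%N - u 1%N).
  elim: n => [|n ih]; first by rewrite expr0 mul1r.
  by apply: le_trans (h _ _) _; rewrite exprS -mulrA ler_wpM2l.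
(* Almost fixed points are close to each other, so the iterates are Cauchy once their steps tend to
   0. *)
have dist x y : (1 - q) * hn (x - y) <= hn (x - phi x) + hn (y - phi y).
  have := hn_distD (phi x) x y; have := hn_distD (phi y) (phi x) y.
  rewrite (hnBC (phi y) y); have := h x y; lra.
have small e : 0 < e -> exists n0, forall n, (n0 <= n)%N -> hn (u n - u n.+1) <= e.
  move=> e0; set c := hn (u 0%N - u 1%N).
  have c1 : 0 < c + 1 by rewrite ltr_wpDl ?hn_ge0.
  have : (GRing.exp q : nat -> R) @ \oo --> (0 : R) by apply: cvg_expr; rewrite ger0_norm.
  move=> /cvgrPdist_le /(_ (e / (c + 1)) (divr_gt0 e0 c1)) [n0 _ hn0].
  exists n0 => n /hn0 /=; rewrite sub0r normrN ger0_norm ?exprn_ge0// ler_pdivlMr// => h1.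
  apply: le_trans (hu n) _; apply: le_trans h1; rewrite -/c.
  by rewrite ler_wpM2l ?exprn_ge0// lerDl.
have q1' : 0 < 1 - q by rewrite subr_gt0.
have [|x /hn_cvgP ux] := @hn_complete _ _ u.
  move=> e e0; have [|n0 hn0] := small ((1 - q) * e / 2); first by rewrite divr_gt0// mulr_gt0.
  exists n0 => m n /hn0 hm /hn0 hn1; rewrite -(ler_pM2l q1').
  have := dist (u m) (u n); rewrite -![phi (u _)]/(u _.+1); lra.
exists x; apply/eqP; rewrite -subr_eq0; apply/eqP; apply: hn_eq0.
apply: (@le_eps0 _ _ 2) => e e0; have [n0 hn0] := ux _ e0.
have h1 := hn0 n0 (leqnn _); have h2 := hn0 n0.+1 (leqnSn _).
rewrite ger0_norm ?hn_ge0//; apply: le_trans (hn_distD (u n0.+1) _ _) _.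
have := h (u n0) x; rewrite -[phi (u _)]/(u _.+1) (hnBC x).
have := hn_ge0 (u n0 - x); nra.
Qed.

(** * Shifts of semibounded forms and the relative bound *)

Section ShiftedForm.
Variables (R : realType) (H : hilbertType R) (a : sesq H) (k : R).
Hypotheses (a_sym : symmetric_sesq a) (a_closed : form_closed a).

Definition shifted_form : sesq H := Sesq (fdom a) (fun x y => a x y + k%:C * '[x, y]).

Lemma shifted_sym : symmetric_sesq shifted_form.
Proof.
have [a0 aZD al ac] := a_sym; split=> //= [c x y w ax ay aw|x y ax ay].
  by rewrite al// linearPl/=; ring.
by rewrite ac// inner_conj rmorphD rmorphM/= conjC_real.
Qed.

Lemma shifted_rform x y : rform shifted_form x y = rform a x y + k * rip x y.
Proof. by rewrite /rform /= ReD Re_scale. Qed.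

Lemma sym_real x : fdom a x -> `|a x x| = `|rform a x x|%:C.
Proof.
move=> ax; have := fform_conj a_sym ax ax; rewrite /rform.
case: (a x x) => u v [] /eqP; rewrite -addr_eq0 -mulr2n mulrn_eq0/= => /eqP ->.
by rewrite normc_def/= expr0n addr0 sqrtr_sqr.
Qed.

Hypothesis a_coer : forall x, fdom a x -> hn x ^+ 2 <= rform shifted_form x x.

(** Coercivity bounds [a] by [1 + |k|] times the shifted form, which transfers the Cauchy condition
    to [a]. On the way back the extra term is a multiple of [hn (u n - x) ^+ 2], small by norm
    convergence. *)
Lemma shifted_closed : form_closed shifted_form.
Proof.
move=> u x fu ux hu; have k1 : 0 < 1 + `|k| by rewrite ltr_pwDl.
have bound y : fdom a y -> `|rform a y y| <= (1 + `|k|) * `|rform shifted_form y y|.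
  move=> ay; have h := a_coer ay.
  have h0 : 0 <= rform shifted_form y y by rewrite (le_trans _ h)// sqr_ge0.
  rewrite (ger0_norm h0); rewrite shifted_rform -hn_sqr in h h0 *.
  have := ler_norm k; have := ler_norm (- k); rewrite normrN => k2 k3.
  rewrite ler_norml; apply/andP; split; nra.
have shifted_real y : fdom a y -> `|shifted_form y y| = `|rform shifted_form y y|%:C.
  move=> ay; have p := coercive_pos (f := shifted_form) a_coer.
  rewrite (fformxx shifted_sym p)// ger0_norm ?ler0c ?sqr_ge0// (fnorm_sqr p)//.
  by rewrite ger0_norm// p.
have [|fx hx] := a_closed fu ux.
  move=> e e0; have := hu (e / (1 + `|k|)) (divr_gt0 e0 k1).
  move=> [/= S hS hS']; exists S => // mn /hS' /=.
  have fd := fdomB a_sym (fu mn.1) (fu mn.2).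
  rewrite shifted_real// sym_real// !ltcR ltr_pdivlMr// mulrC; apply: le_lt_trans.
  exact: bound.
split => // e e0.
have e2 : 0 < e / 2 by rewrite divr_gt0.
have [n0 _ h1] := hx _ e2.
have e3 : 0 < Num.sqrt (e / 2 / (1 + `|k|)) by rewrite sqrtr_gt0 divr_gt0.
move/hn_cvgP: ux => /(_ _ e3) [n1 h2].
exists (maxn n0 n1) => // n /=; rewrite geq_max => /andP[/h1 /= h3 /h2 h4].
have fd := fdomB a_sym (fu n) fx.
rewrite sym_real// ltcR in h3; rewrite shifted_real// ltcR shifted_rform -hn_sqr.
apply: le_lt_trans (ler_normD _ _) _.
have {}h4 : (1 + `|k|) * hn (u n - x) ^+ 2 <= e / 2.
  rewrite mulrC -ler_pdivlMr// -(sqr_sqrtr (ltW (divr_gt0 e2 k1))).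
  by rewrite ler_pXn2r ?nnegrE ?sqrtr_ge0 ?hn_ge0.
rewrite normrM [`|_ ^+ 2|]ger0_norm ?sqr_ge0//.
have := sqr_ge0 (hn (u n - x)); nra.
Qed.

End ShiftedForm.

Section RelativeBound.
Variables (R : realType) (H1 H2 : hilbertType R) (B : operator H2 H1) (a : sesq H1).
Hypotheses (a_sym : symmetric_sesq a) (a_below : form_bounded_below a).
Hypotheses (a_closed : form_closed a).
Hypotheses (B_lin : linear_operator B) (B_dense : densely_defined B).
Hypothesis dom_a : fdom a `<=` dom (adjoint B).

Lemma app_adjoint x : fdom a x -> adjoint B (x, app (adjoint B) x).
Proof.
by move=> /dom_a [y xy]; exact: (@xgetPex _ 0 [set y | adjoint B (x, y)] (ex_intro _ y xy)).
Qed.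

Lemma below_rform : exists c : R, forall x, fdom a x -> c * hn x ^+ 2 <= rform a x x.
Proof.
have [c hc] := a_below; exists c => x /hc.
by rewrite lecE normE -rmorphXn -rmorphM /= => /andP[].
Qed.

Lemma relative_bound_gt (d : R) : relative_bound B a < d -> exists b k : R,
  [/\ 0 < b < d, forall x, fdom a x -> hn x ^+ 2 <= rform (shifted_form a k) x x &
   forall x v, fdom a x -> adjoint B (x, v) -> hn v ^+ 2 <= b * rform (shifted_form a k) x x].
Proof.
have [c hc] := below_rform.
have coer k : 1 <= c + k ->
    forall x, fdom a x -> hn x ^+ 2 <= rform (shifted_form a k) x x.
  move=> ck x /hc; rewrite shifted_rform -hn_sqr; have := sqr_ge0 (hn x); nra.
rewrite /relative_bound; set E := (X in inf X) => Ed.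
(* The infimum of the empty set is 0 by convention, so [Ed] yields a usable bound only once [E] has
   a member; the gliding hump supplies one. *)
have E0 : E !=set0.
  have ck : 1 <= c + (1 - c) by rewrite addrC subrK.
  have [C hC] := adjoint_form_bounded (shifted_sym (1 - c) a_sym)
    (shifted_closed a_sym a_closed (coer _ ck)) (coer _ ck) B_lin B_dense dom_a.
  exists (C ^+ 2); split; first exact: sqr_ge0.
  exists (C ^+ 2 * (1 - c)) => x ax; have h := hC _ _ ax (app_adjoint ax).
  have : hn (app (adjoint B) x) ^+ 2 <= (C * fnorm (shifted_form a (1 - c)) x) ^+ 2.
    by rewrite ler_pXn2r// ?nnegrE ?hn_ge0// (le_trans _ h) ?hn_ge0.
  rewrite exprMn (fnorm_sqr (coercive_pos (f := shifted_form a (1 - c)) (coer _ ck)))// shifted_rform -hn_sqr.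
  have [aa _ _ ac] := a_sym; have := ac x x ax ax; rewrite /rform !normE.
  case: (a x x) => u v [] /eqP; rewrite -addr_eq0 -mulr2n mulrn_eq0/= => /eqP -> h1.
  by rewrite -!rmorphXn -!rmorphM -rmorphD/= lecR; lra.
have [b1 [b10 [al hal]] b1d] := inf_lt E0 Ed.
(* The gap [b - b1] absorbs the constant [al]: this [k] makes [(b - b1) (a + k)[x]] at least
   [|al| |x|^2]. The choice also ensures [0 < b], even when [b1 = 0]. *)
pose b : R := (b1 + d) / 2; pose k : R := `|c| + 1 + `|al| / (b - b1).
have bb : 0 < b - b1 by rewrite /b; lra.
have ck : 1 + `|al| / (b - b1) <= c + k by rewrite /k; have := ler_norm (- c); rewrite normrN; lra.
have al0 : 0 <= `|al| / (b - b1) by rewrite divr_ge0// ltW.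
have ck1 : 1 <= c + k by lra.
exists b, k; split; [by rewrite /b; lra|exact: coer|].
move=> x v ax xv.
have := hal x ax; rewrite (adjoint_single B_dense (app_adjoint ax) xv) !normE.
rewrite lecE => /andP[_]; rewrite -!rmorphXn -!rmorphM ReD Re_scale/= -/(rform a x x) => h1.
have h2 := hc x ax; rewrite shifted_rform -hn_sqr.
have h3 : 0 <= hn x ^+ 2 by exact: sqr_ge0.
have h4 : (1 + `|al| / (b - b1)) * hn x ^+ 2 <= rform a x x + k * hn x ^+ 2 by nra.
have h5 : (b - b1) * ((1 + `|al| / (b - b1)) * hn x ^+ 2) <=
    (b - b1) * (rform a x x + k * hn x ^+ 2) by rewrite ler_pM2l.
have h6 : (b - b1) * ((1 + `|al| / (b - b1)) * hn x ^+ 2) =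
    (b - b1) * hn x ^+ 2 + `|al| * hn x ^+ 2 by field; rewrite gt_eqF.
have h7 : al * hn x ^+ 2 <= `|al| * hn x ^+ 2 by rewrite ler_wpM2r// ler_norm.
have k0 : 0 <= k by rewrite /k; have := normr_ge0 c; lra.
have h8 : 0 <= b1 * (k * hn x ^+ 2) by apply: mulr_ge0 => //; apply: mulr_ge0.
have h9 : 0 <= (b - b1) * hn x ^+ 2 by rewrite mulr_ge0// ltW.
lra.
Qed.

End RelativeBound.

(** * The closure of the block operator *)

Section BlockOperator.
Variables (R : realType) (H1 H2 : hilbertType R).
Variables (A : operator H1 H1) (B : operator H2 H1) (D : operator H2 H2).
Variable a : sesq H1.
Hypotheses (a_sym : symmetric_sesq a) (a_closed : form_closed a).
Hypothesis A_form : operator_of_form a = A.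
Hypothesis B_dense : densely_defined B.
Hypothesis dom_a : fdom a `<=` dom (adjoint B).
Hypothesis D_sa : self_adjoint D.
Hypothesis D_core : forall y w, D (y, w) -> forall e : R, 0 < e ->
  exists y' w' v', [/\ D (y', w'), B (y', v'), hn (y - y') < e & hn (w - w') < e].

Variables (b k : R).
Hypothesis b0 : 0 < b.
Hypothesis coer : forall x, fdom a x -> hn x ^+ 2 <= rform (shifted_form a k) x x.
Hypothesis B_bound : forall x v, fdom a x -> adjoint B (x, v) ->
  hn v ^+ 2 <= b * rform (shifted_form a k) x x.

Local Notation V := (fdom a).
Local Notation f := (shifted_form a k).
Local Notation N := (fnorm f).
Local Notation Bs := (app (adjoint B)).
Local Notation s := (Num.sqrt b).
Let f_sym : symmetric_sesq f := shifted_sym k a_sym.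
Let f_closed : form_closed f := shifted_closed a_sym a_closed coer.
Let f_pos := coercive_pos (f := f) coer.
Let D_lin : linear_operator D. Proof. by case: D_sa. Qed.

Let s0 : 0 < s. Proof. by rewrite sqrtr_gt0. Qed.
Let s2 : s ^+ 2 = b. Proof. by rewrite sqr_sqrtr// ltW. Qed.

Lemma BsZD c x y : V x -> V y -> Bs (c *: x + y) = c *: Bs x + Bs y.
Proof.
move=> Vx Vy; have Vxy := fdomZD a_sym c Vx Vy.
apply: (adjoint_single B_dense (app_adjoint dom_a Vxy)).
by apply: adjoint_linear; exact: (app_adjoint dom_a).
Qed.

Lemma Bs0 : Bs 0 = 0.
Proof.
have V0 := fdom0 a_sym.
by have := BsZD (-1) V0 V0; rewrite scaler0 addr0 scaleN1r addNr.
Qed.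

Lemma BsZ c x : V x -> Bs (c *: x) = c *: Bs x.
Proof. by move=> Vx; have := BsZD c Vx (fdom0 a_sym); rewrite Bs0 !addr0. Qed.

Lemma BsD x y : V x -> V y -> Bs (x + y) = Bs x + Bs y.
Proof. by move=> Vx Vy; have := BsZD 1 Vx Vy; rewrite !scale1r. Qed.

Lemma BsB x y : V x -> V y -> Bs (x - y) = Bs x - Bs y.
Proof. by move=> Vx Vy; have := BsZD (-1) Vy Vx; rewrite !scaleN1r [- y + x]addrC [- Bs y + _]addrC. Qed.

Lemma Bs_adj y v w : V w -> B (y, v) -> '[v, w] = '[y, Bs w].
Proof. by move=> Vw Byv; exact: (app_adjoint dom_a Vw Byv). Qed.

Lemma Bs_bound x : V x -> hn (Bs x) <= s * N x.
Proof.
move=> Vx; rewrite -(ler_pXn2r (n := 2)) ?nnegrE ?mulr_ge0 ?hn_ge0 ?fnorm_ge0 ?sqrtr_ge0//.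
by rewrite exprMn s2 (fnorm_sqr f_pos)//; exact: B_bound (app_adjoint dom_a Vx).
Qed.

(** Replacing [w] by ['i w] turns the real parts of the two sides into their imaginary parts. *)
Lemma form_eqP x (F : H1) (h : H2) : V x ->
  (forall w, V w -> f x w = '[F, w] + '[h, Bs w]) <->
  (forall w, V w -> rform f x w = rip F w + rip h (Bs w)).
Proof.
move=> Vx; split=> h1 w Vw; first by rewrite /rform h1// ReD.
apply/eqP; rewrite eq_complex -!Re_mul_conji; apply/andP; split; apply/eqP.
  by rewrite [in RHS]ReD; exact: h1.
have Viw := fdomZ a_sym 'i%C Vw; have := h1 _ Viw.
rewrite /rform (fformZr f_sym)// => ->; rewrite BsZ// /rip !linearZr_LR/=.
by rewrite mulrDr ReD.
Qed.

Lemma form_solve (F : H1) (h : H2) :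
  exists2 x, V x & forall w, V w -> f x w = '[F, w] + '[h, Bs w].
Proof.
have [||| x Vx hx] := @form_riesz _ _ f f_sym f_closed coer
    (fun w => rip F w + rip h (Bs w)) (hn F + s * hn h).
- move=> x y Vx Vy; rewrite BsD// !(ripC F) !(ripC h) !ripDl; ring.
- by move=> t x Vx; rewrite BsZ// !(ripC F) !(ripC h) !ripZl mulrDr.
- move=> x Vx; apply: le_trans (ler_normD _ _) _; rewrite mulrDl; apply: lerD.
    apply: le_trans (rip_CS _ _) _; rewrite ler_wpM2l ?hn_ge0//.
    exact: (hn_le_fnorm (f := f)).
  apply: le_trans (rip_CS _ _) _; rewrite -mulrA mulrCA ler_wpM2l ?hn_ge0//.
  exact: Bs_bound.
by exists x => //; apply/form_eqP.
Qed.

(* The weak form of the block operator: the first row is read in the form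
   sense, so that only [x \in dom a] is required. *)
Definition weak_block : operator (H1 * H2)%type (H1 * H2)%type :=
  [set p | [/\ V p.1.1, D (p.1.2, p.2.2 + Bs p.1.1) &
    forall w, V w -> a p.1.1 w + '[p.1.2, Bs w] = '[p.2.1, w]]].

Lemma weak_rowP x y (F : H1) : V x ->
  (forall w, V w -> a x w + '[y, Bs w] = '[F, w]) <->
  (forall w, V w -> rform f x w = rip (F + k%:C *: x) w - rip y (Bs w)).
Proof.
move=> Vx; rewrite (_ : (forall w, V w -> rform f x w = _) <->
  (forall w, V w -> rform f x w = rip (F + k%:C *: x) w + rip (- y) (Bs w))); last first.
  by split=> h w Vw; rewrite h// ripNl.
rewrite -form_eqP//; split=> h w Vw.
  rewrite /= linearDl/= linearZl_LR/= linearNl/= -h//; ring.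
move: (h w Vw); rewrite /= linearDl/= linearZl_LR/= linearNl/= => h1.
have -> : a x w = a x w + k%:C * '[x, w] - k%:C * '[x, w] by ring.
rewrite h1; ring.
Qed.

Lemma block_sub_weak : block_op A B D `<=` weak_block.
Proof.
move=> [[x y] [F g]] [Ax [By [Bsx [Dy [/= Axx Byy Bx Dyy [-> ->]]]]]].
move: Axx; rewrite -A_form => -[/= Vx Axx].
split=> //=.
  by rewrite (adjoint_single B_dense Bx (app_adjoint dom_a Vx)) addrAC addNr add0r.
by move=> w Vw; rewrite Axx// -(Bs_adj Vw Byy) linearDl.
Qed.

(** Since [x] need not lie in [dom A], it is replaced too: for [y'] in [dom B] near [y], the
    equation [A x' + k x' = F + k x - B y'] is solved. The first row then holds strictly up to
    [k (x - x')], and [x' - x] is small in form norm because only [y - y'] drives it. *)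
Lemma weak_sub_closure : weak_block `<=` closure (block_op A B D).
Proof.
move=> [[x y] [F g]] [/= Vx Dy Fx]; apply/closureP_quad => e e0.
(* In units of [e1] the errors are at most [s] for [x], 1 for [y], [|k| s] for [F], and [1 + b] for
   [g], with [b = s * s]. *)
pose c := 1 + s + `|k| * s + b.
have c0 : 0 < c by rewrite /c ltr_wpDl// !addr_ge0 ?mulr_ge0// ltW.
pose e1 := e / c; have e10 : 0 < e1 by rewrite divr_gt0.
have [y' [w' [v' [Dy' By' hy hw]]]] := D_core Dy e10.
have [x' Vx' hx'] := form_solve (F + k%:C *: x - v') 0.
have dV := fdomB f_sym Vx' Vx.
have dx : forall w, V w -> rform f (x' - x) w = rip (y - y') (Bs w).
  move=> w Vw; rewrite (rformBl f_sym)// {1}/rform hx'//.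
  rewrite ((weak_rowP y F Vx).1 Fx w Vw) linear0l addr0 -/(rip _ _).
  rewrite !ripBl (_ : rip v' w = rip y' (Bs w)); last by rewrite /rip (Bs_adj Vw By').
  ring.
have Nx : N (x' - x) <= s * hn (y - y').
  have : N (x' - x) ^+ 2 <= N (x' - x) * (s * hn (y - y')).
    rewrite (fnorm_sqr f_pos)// dx//; apply: le_trans (ler_norm _) _.
    apply: le_trans (rip_CS _ _) _; rewrite mulrA mulrC ler_wpM2r ?hn_ge0// mulrC.
    exact: Bs_bound.
  have [->|n0] := eqVneq (N (x' - x)) 0; first by rewrite mulr_ge0 ?hn_ge0// ltW.
  by rewrite expr2 ler_pM2l// lt_neqAle eq_sym n0 fnorm_ge0.
have Hx := hn_le_fnorm (f := f) coer dV.
have se : s * hn (y - y') <= s * e1 by rewrite ler_pM2l// ltW.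
have ce : (1 + s + `|k| * s + b) * e1 = e by rewrite /e1 mulrC divfK// gt_eqF.
have ks : 0 <= `|k| * s * e1 by apply: mulr_ge0 (ltW e10); apply: mulr_ge0 (ltW s0).
have be : 0 < b * e1 by rewrite mulr_gt0.
have se0 : 0 < s * e1 by rewrite mulr_gt0.
exists x', y', (F + k%:C *: (x - x')), (w' - Bs x'); split.
- exists (F + k%:C *: (x - x') - v'), v', (Bs x'), w'; split => //=.
  + rewrite -A_form; split => //= w Vw; move: (hx' w Vw).
    rewrite linear0l addr0 /= !linearDl/= !linearNl/= scalerBr linearBl/=.
    rewrite ![inner (k%:C *: _) w]linearZl_LR/= => h.
    have -> : a x' w = a x' w + k%:C * '[x', w] - k%:C * '[x', w] by ring.
    rewrite h; ring.
  + exact: (app_adjoint dom_a Vx').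
  + by rewrite subrK [- _ + w']addrC.
- rewrite hnBC; lra.
- lra.
- rewrite opprD addrA subrr add0r hnN hnZ/= expr0n addr0 sqrtr_sqr hnBC.
  have : `|k| * hn (x' - x) <= `|k| * (s * e1) by rewrite ler_wpM2l//; lra.
  nra.
- rewrite (_ : g - _ = (g + Bs x - w') + Bs (x' - x)); last first.
    by rewrite BsB// opprB [RHS]addrAC [(g + _) + _]addrACA subrr addr0 addrA.
  apply: le_lt_trans (hnD _ _) _.
  have := Bs_bound dV; have : s * N (x' - x) <= s * (s * e1) by rewrite ler_pM2l//; lra.
  rewrite [s * (s * _)]mulrA -expr2 s2; lra.
Qed.

Variables (z : R[i]) (d : R).
Hypothesis bd : b < d.
Hypothesis zD : resolvent_set D z.
Hypothesis D_low : forall x y, D (x, y) -> d * hn x <= hn (y - z *: x).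

Local Notation Rz := (resol D z).
Let d0 : 0 < d. Proof. exact: lt_trans b0 bd. Qed.

Lemma Rz_bound y : d * hn (Rz y) <= hn y.
Proof. by have := D_low (resolP y zD); rewrite addrK. Qed.

(** Test the first row with [x] and insert [d |y| <= |g| + s N x] from the second: the coupling
    costs at most [b / d] of [N x ^+ 2], which [b < d] lets the form absorb. Both the closedness of
    the weak block and the resolvent bound rest on this. *)
Lemma weak_estimate x y q (G : H1) (g : H2) : V x -> D (y, q) -> q - z *: y = g + Bs x ->
  (forall w, V w -> rform f x w = rip G w - rip y (Bs w)) ->
  (d - b) * N x <= d * hn G + s * hn g.
Proof.
move=> Vx Dyq qE h; have := h x Vx; rewrite -(fnorm_sqr f_pos)// => h1.
have := D_low Dyq; rewrite qE => h2.
have h3 := Bs_bound Vx; have h4 := hnD g (Bs x).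
have h5 := rip_CS G x; have h6 := rip_CS y (Bs x).
have h7 := hn_le_fnorm (f := f) coer Vx.
have n0 := fnorm_ge0 f x.
have [n1|n1] := eqVneq (N x) 0.
  by rewrite n1 mulr0 addr_ge0// mulr_ge0 ?hn_ge0// ltW.
have {}n1 : 0 < N x by rewrite lt_neqAle eq_sym n1 n0.
rewrite -(ler_pM2r n1).
have g0 := hn_ge0 g; have G0 := hn_ge0 G; have y0 := hn_ge0 y.
have e1 : d * hn y * hn (Bs x) <= (hn g + s * N x) * (s * N x).
  apply: ler_pM; rewrite ?hn_ge0//; [by rewrite mulr_ge0// ltW|lra].
have e2 : d * (hn G * hn x) <= d * (hn G * N x) by rewrite ler_pM2l// ler_wpM2l.
have e3 : d * N x ^+ 2 <= d * (hn G * hn x) + d * (hn y * hn (Bs x)).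
  rewrite -mulrDr ler_pM2l// h1; move: h5 h6; rewrite !ler_norml => /andP[_ ?] /andP[? _]; lra.
have e4 : (s * N x) * (s * N x) = b * N x ^+ 2 by rewrite mulrACA -!expr2 s2.
lra.
Qed.

(** An adjoint is closed, and [D] is its own adjoint. *)
Lemma op_closed y w : (forall e : R, 0 < e -> exists y' w',
    [/\ D (y', w'), hn (y' - y) <= e & hn (w' - w) <= e]) -> D (y, w).
Proof.
case: (D_sa) => _ _ Dadj h; rewrite -Dadj => u v Duv /=.
have re u' v' : D (u', v') -> rip v' y = rip u' w.
  move=> Duv'; apply/eqP; rewrite -subr_eq0; apply/eqP.
  apply: (@le_eps0 _ _ (hn v' + hn u')) => e /h [y' [w' [Dyw hy hw]]].
  have E : rip v' y' = rip u' w' by rewrite /rip (sa_sym D_sa Duv' Dyw).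
  have -> : rip v' y - rip u' w = rip (w' - w) u' - rip (y' - y) v'.
    by rewrite !ripBl -!(ripC v') -!(ripC u') -E; ring.
  apply: le_trans (ler_normB _ _) _; rewrite mulrDl addrC; apply: lerD.
    by apply: le_trans (rip_CS _ _) _; rewrite mulrC ler_wpM2l ?hn_ge0.
  by apply: le_trans (rip_CS _ _) _; rewrite mulrC ler_wpM2l ?hn_ge0.
apply/eqP; rewrite eq_complex -!Re_mul_conji; apply/andP; split; apply/eqP; first exact: re.
by have := re _ _ (opZ D_lin (conjC 'i%C) Duv); rewrite /rip !linearZl_LR.
Qed.

(** Graph convergence gives norm convergence of the first components only; [weak_estimate] upgrades
    it to form convergence, as the terms [a x w] and [Bs x] require. The point [z] is absent from
    the statement: a single one with lower bound [d > b] suffices. *)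
Lemma weak_closed : closure weak_block `<=` weak_block.
Proof.
move=> [[x y] [F g]] /closureP_quad cl.
have [u hu] : {u : nat -> (H1 * H2) * (H1 * H2) & forall n, [/\ weak_block (u n),
    hn (x - (u n).1.1) < n.+1%:R^-1, hn (y - (u n).1.2) < n.+1%:R^-1,
    hn (F - (u n).2.1) < n.+1%:R^-1 & hn (g - (u n).2.2) < n.+1%:R^-1]}.
  apply: (@choice _ _ (fun n u => [/\ weak_block u,
    hn (x - u.1.1) < n.+1%:R^-1, hn (y - u.1.2) < n.+1%:R^-1,
    hn (F - u.2.1) < n.+1%:R^-1 & hn (g - u.2.2) < n.+1%:R^-1])) => n.
  have [|x' [y' [F' [g' h]]]] := cl n.+1%:R^-1; first by rewrite invr_gt0.
  by exists ((x', y'), (F', g')).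
have Vu n : V (u n).1.1 by case: (hu n) => -[].
have small e : 0 < e -> exists n0, forall n, (n0 <= n)%N -> [/\
    hn ((u n).1.1 - x) <= e, hn ((u n).1.2 - y) <= e,
    hn ((u n).2.1 - F) <= e & hn ((u n).2.2 - g) <= e].
  move=> /invn_small[n0 hn0]; exists n0 => n /hn0 hn1.
  case: (hu n) => _ h1 h2 h3 h4; rewrite !(hnBC (u n).1.1) !(hnBC (u n).1.2) !(hnBC (u n).2.1) !(hnBC (u n).2.2).
  by split; apply: le_trans hn1; exact: ltW.
(* If all component differences are at most [2 r], then [c * r] bounds the right side of
   [weak_estimate], including the shifts by [k] and [z]. *)
pose c := 2 * (d * (1 + `|k|) + s * (1 + Normc.normc z)).
have nz0 : 0 <= Normc.normc z by case: (z) => ? ?; exact: sqrtr_ge0.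
have c0 : 0 < c.
  rewrite /c mulr_gt0// addr_gt0// mulr_gt0// ltr_pwDl//.
have db : 0 < d - b by rewrite subr_gt0.
have [|x' Vx' hx'] := @form_complete _ _ f f_sym f_closed coer (fun n => (u n).1.1) Vu.
  move=> e e0; have [|n0 hn0] := small ((d - b) * e / c); first by rewrite divr_gt0// mulr_gt0.
  exists n0 => m n /hn0[x1 y1 F1 g1] /hn0[x2 y2 F2 g2].
  have [[_ D1 W1] _ _ _ _] := hu m; have [[_ D2 W2] _ _ _ _] := hu n.
  move: (u m) (u n) (Vu m) (Vu n) x1 y1 F1 g1 D1 W1 x2 y2 F2 g2 D2 W2.
  move=> [[x1 y1] [F1 g1]] [[x2 y2] [F2 g2]] /= V1 V2 hx1 hy1 hF1 hg1 D1 W1 hx2 hy2 hF2 hg2 D2 W2.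
  have := @weak_estimate (x1 - x2) (y1 - y2) _ (F1 - F2 + k%:C *: (x1 - x2))
    (g1 - g2 - z *: (y1 - y2)) (fdomB f_sym V1 V2) (opB D_lin D1 D2).
  have -> : g1 + Bs x1 - (g2 + Bs x2) - z *: (y1 - y2) =
      g1 - g2 - z *: (y1 - y2) + Bs (x1 - x2).
    by rewrite BsB// opprD addrACA [LHS]addrAC.
  move=> /(_ erefl) h.
  have {}h : (d - b) * N (x1 - x2) <= d * hn (F1 - F2 + k%:C *: (x1 - x2)) +
      s * hn (g1 - g2 - z *: (y1 - y2)).
    apply: h => w Vw; rewrite (rformBl f_sym)//.
    rewrite ((weak_rowP y1 F1 V1).1 W1 w Vw) ((weak_rowP y2 F2 V2).1 W2 w Vw).
    by rewrite !(ripDl, ripZl, ripNl); ring.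
  rewrite -(ler_pM2l db).
  set r := (d - b) * e / c in hx1 hy1 hF1 hg1 hx2 hy2 hF2 hg2.
  have cr : c * r = (d - b) * e by rewrite /r mulrC divfK// gt_eqF.
  rewrite -cr; apply: le_trans h _.
  have dist (K : hilbertType R) (p q o : K) : hn (p - o) <= r -> hn (q - o) <= r -> hn (p - q) <= 2 * r.
    by move=> h1 h2; apply: le_trans (hn_distD o _ _) _; rewrite (hnBC o); lra.
  have j1 := hnD (F1 - F2) (k%:C *: (x1 - x2)).
  rewrite hnZ/= expr0n addr0 sqrtr_sqr in j1.
  have j2 := hnD (g1 - g2) (- (z *: (y1 - y2))); rewrite hnN hnZ in j2.
  have k1 := dist _ _ _ _ hx1 hx2; have k2 := dist _ _ _ _ hy1 hy2.
  have k3 := dist _ _ _ _ hF1 hF2; have k4 := dist _ _ _ _ hg1 hg2.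
  have l1 : `|k| * hn (x1 - x2) <= `|k| * (2 * r) by rewrite ler_wpM2l.
  have l2 : Normc.normc z * hn (y1 - y2) <= Normc.normc z * (2 * r) by rewrite ler_wpM2l.
  have m1 : d * hn (F1 - F2 + k%:C *: (x1 - x2)) <= d * ((1 + `|k|) * (2 * r)).
    by rewrite ler_pM2l//; lra.
  have m2 : s * hn (g1 - g2 - z *: (y1 - y2)) <= s * ((1 + Normc.normc z) * (2 * r)).
    by rewrite ler_pM2l//; lra.
  by rewrite /c; lra.
have xx' : x' = x.
  apply/eqP; rewrite -subr_eq0; apply/eqP; apply: hn_eq0.
  apply: (@le_eps0 _ _ 2) => e e0; have [n0 hn0] := small _ e0; have [n1 hn1] := hx' _ e0.
  have [h1 _ _ _] := hn0 _ (leq_maxl n0 n1); have := hn1 _ (leq_maxr n0 n1).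
  move: (maxn _ _) h1 => n h1 h2; rewrite ger0_norm ?hn_ge0//.
  apply: le_trans (hn_distD (u n).1.1 _ _) _; rewrite (hnBC x').
  have := hn_le_fnorm (f := f) coer (fdomB f_sym (Vu n) Vx'); lra.
rewrite {x'}xx' in Vx' hx'.
have approx e : 0 < e -> exists n, [/\ N ((u n).1.1 - x) <= e,
    hn ((u n).1.2 - y) <= e, hn ((u n).2.1 - F) <= e & hn ((u n).2.2 - g) <= e].
  move=> e0; have [n0 hn0] := small _ e0; have [n1 hn1] := hx' _ e0.
  exists (maxn n0 n1); have [_ h1 h2 h3] := hn0 _ (leq_maxl n0 n1).
  by split=> //; exact: hn1 (leq_maxr n0 n1).
split=> //=.
  apply: op_closed => e e0; have s1 : 0 < 1 + s by rewrite addr_gt0.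
  have [n [h1 h2 h3 h4]] := approx _ (divr_gt0 e0 s1).
  have le1 : e / (1 + s) <= e by rewrite ler_pdivrMr// ler_pMr// lerDl ltW.
  exists (u n).1.2, ((u n).2.2 + Bs (u n).1.1); have [[_ Du _] _ _ _ _] := hu n; split => //.
    exact: le_trans h2 _.
  have -> : (u n).2.2 + Bs (u n).1.1 - (g + Bs x) = (u n).2.2 - g + Bs ((u n).1.1 - x).
    by rewrite BsB// opprD addrACA.
  apply: le_trans (hnD _ _) _.
  have := Bs_bound (fdomB f_sym (Vu n) Vx').
  have : s * N ((u n).1.1 - x) <= s * (e / (1 + s)) by rewrite ler_pM2l.
  have : (1 + s) * (e / (1 + s)) = e by rewrite mulrC divfK// gt_eqF.
  lra.
apply/weak_rowP => // w Vw; apply/eqP; rewrite -subr_eq0; apply/eqP.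
apply: (@le_eps0 _ _ (N w + hn w + `|k| * hn w + hn (Bs w))) => e e0.
have [n [h1 h2 h3 h4]] := approx _ e0; have [[_ _ Wu] _ _ _ _] := hu n.
have Vd := fdomB f_sym (Vu n) Vx'.
have -> : rform f x w - (rip (F + k%:C *: x) w - rip y (Bs w)) =
    rip ((u n).2.1 - F) w + k * rip ((u n).1.1 - x) w - rip ((u n).1.2 - y) (Bs w)
      - rform f ((u n).1.1 - x) w.
  rewrite (rformBl f_sym (Vu n))// ((weak_rowP _ _ (Vu n)).1 Wu w Vw).
  by rewrite !(ripDl, ripZl, ripNl); ring.
have j1 := rip_CS ((u n).2.1 - F) w; have j2 := rip_CS ((u n).1.1 - x) w.
have j3 := rip_CS ((u n).1.2 - y) (Bs w); have j4 := rform_CS f_sym f_pos Vd Vw.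
have j5 := hn_le_fnorm (f := f) coer Vd.
have t1 := ler_normB (rip ((u n).2.1 - F) w + k * rip ((u n).1.1 - x) w -
  rip ((u n).1.2 - y) (Bs w)) (rform f ((u n).1.1 - x) w).
have t2 := ler_normB (rip ((u n).2.1 - F) w + k * rip ((u n).1.1 - x) w)
  (rip ((u n).1.2 - y) (Bs w)).
have t3 := ler_normD (rip ((u n).2.1 - F) w) (k * rip ((u n).1.1 - x) w).
rewrite normrM in t3; apply: le_trans t1 _.
have k1 : hn ((u n).2.1 - F) * hn w <= e * hn w by rewrite ler_wpM2r ?hn_ge0.
have k2 : hn ((u n).1.1 - x) * hn w <= e * hn w by rewrite ler_wpM2r ?hn_ge0//; lra.
have k3 : hn ((u n).1.2 - y) * hn (Bs w) <= e * hn (Bs w) by rewrite ler_wpM2r ?hn_ge0.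
have k4 : N ((u n).1.1 - x) * N w <= e * N w by rewrite ler_wpM2r ?fnorm_ge0.
have k5 : `|k| * `|rip ((u n).1.1 - x) w| <= `|k| * (e * hn w) by rewrite ler_wpM2l//; lra.
lra.
Qed.

Lemma closure_block : closure (block_op A B D) = weak_block.
Proof.
apply/seteqP; split; last exact: weak_sub_closure.
exact: subset_trans (closureS block_sub_weak) weak_closed.
Qed.

End BlockOperator.

Lemma normE_pair (R : realType) (H K : hilbertType R) (x : H) (y : K) :
  `|(x, y)| = (Num.max (hn x) (hn y))%:C.
Proof. by rewrite prod_normE /= !normE /Order.max ltcR; case: ifP. Qed.

(** * Resolvent, eigenvalues and kernel of the Schur complement *)

Section SchurComplement.
Variables (R : realType) (H1 H2 : hilbertType R).
Variables (B : operator H2 H1) (D : operator H2 H2).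
Variable a : sesq H1.
Hypotheses (a_sym : symmetric_sesq a) (a_closed : form_closed a).
Hypothesis B_dense : densely_defined B.
Hypothesis dom_a : fdom a `<=` dom (adjoint B).
Hypothesis D_sa : self_adjoint D.
Variables (b k : R).
Hypothesis b0 : 0 < b.
Hypothesis coer : forall x, fdom a x -> hn x ^+ 2 <= rform (shifted_form a k) x x.
Hypothesis B_bound : forall x v, fdom a x -> adjoint B (x, v) ->
  hn v ^+ 2 <= b * rform (shifted_form a k) x x.
Variables (z : R[i]) (d : R).
Hypothesis bd : b < d.
Hypothesis zD : resolvent_set D z.
Hypothesis D_low : forall x y, D (x, y) -> d * hn x <= hn (y - z *: x).

Local Notation V := (fdom a).
Local Notation f := (shifted_form a k).
Local Notation N := (fnorm f).
Local Notation Bs := (app (adjoint B)).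
Local Notation s := (Num.sqrt b).
Local Notation Rz := (resol D z).
Local Notation W := (weak_block B D a).
Local Notation S := (schur_complement B D a z).
Let f_sym : symmetric_sesq f := shifted_sym k a_sym.
Let f_pos := coercive_pos (f := f) coer.
Let D_lin : linear_operator D. Proof. by case: D_sa. Qed.
Let s0 : 0 < s. Proof. by rewrite sqrtr_gt0. Qed.
Let s2 : s ^+ 2 = b. Proof. by rewrite sqr_sqrtr// ltW. Qed.
Let d0 : 0 < d. Proof. exact: lt_trans b0 bd. Qed.
Let db : 0 < d - b. Proof. by rewrite subr_gt0. Qed.

Let RzZD c x y : Rz (c *: x + y) = c *: Rz x + Rz y.
Proof. exact: resolZD. Qed.

Let Rz0 : Rz 0 = 0.
Proof. by have := RzZD (-1) 0 0; rewrite scaler0 addr0 scaleN1r addNr. Qed.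

Let RzD x y : Rz (x + y) = Rz x + Rz y.
Proof. by have := RzZD 1 x y; rewrite !scale1r. Qed.

Let RzN x : Rz (- x) = - Rz x.
Proof. by have := RzZD (-1) x 0; rewrite Rz0 !addr0 !scaleN1r. Qed.

Let BsB := BsB a_sym B_dense dom_a.
Let Bs_bound := Bs_bound dom_a b0 coer B_bound.

Let weak_shiftE x y F g : shift_op W z ((x, y), (F, g)) = W ((x, y), (F + z *: x, g + z *: y)).
Proof. by []. Qed.

Lemma weak_shiftP x y F g : W ((x, y), (F + z *: x, g + z *: y)) <->
  [/\ V x, y = Rz (g + Bs x) &
   forall w, V w -> a x w - z * '[x, w] + '[y, Bs w] = '[F, w]].
Proof.
split=> [[/= Vx Dy h]|[Vx -> h]]; split => //=.
- by apply: resol_uniq => //; rewrite addrAC.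
- by move=> w Vw; rewrite addrAC h// linearDl/= linearZl_LR/= addrK.
- by rewrite addrAC; exact: resolP.
- by move=> w Vw; rewrite linearDl/= linearZl_LR/= -h//; ring.
Qed.

(* The map [h |-> Rz (Bs (G h))], where [G h] solves [f (G h) w = '[h, Bs w]],
   has norm at most [b / d < 1], so that [h' = h - Rz (Bs (G h'))] is solvable. *)
Lemma coercive_solve h : exists x, [/\ V x, (d - b) * N x <= d * (s * hn h) &
  forall w, V w -> f x w + '[Rz (Bs x), Bs w] = '[h, Bs w]].
Proof.
have [G hG] : {G : H2 -> H1 & forall h, V (G h) /\ forall w, V w -> f (G h) w = '[h, Bs w]}.
  apply: (@choice _ _ (fun h x => V x /\ forall w, V w -> f x w = '[h, Bs w])) => h'.
  have [x Vx hx] := form_solve a_sym a_closed B_dense dom_a b0 coer B_bound 0 h'.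
  by exists x; split => // w Vw; rewrite hx// linear0l add0r.
pose phi h' := h - Rz (Bs (G h')).
have [|h1 h2|h' hh] := @contraction_fixpoint _ _ (b / d) phi.
- by rewrite divr_ge0 ?(ltW b0) ?(ltW d0)//= ltr_pdivrMr// mul1r.
- have [V1 G1] := hG h1; have [V2 G2] := hG h2.
  have Vd := fdomB f_sym V1 V2.
  have -> : phi h1 - phi h2 = - Rz (Bs (G h1 - G h2)).
    by rewrite /phi BsB// RzD RzN opprB [RHS]opprB addrC addrA subrK.
  rewrite hnN.
  have n2 : N (G h1 - G h2) ^+ 2 <= hn (h1 - h2) * hn (Bs (G h1 - G h2)).
    rewrite (fnorm_sqr f_pos)// (rformBl f_sym V1 V2 Vd) {1 2}/rform G1// G2//.
    rewrite -/(rip _ _) -/(rip _ _) -ripBl.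
    exact: le_trans (ler_norm _) (rip_CS _ _).
  have n3 := Bs_bound Vd.
  have n4 : hn (Bs (G h1 - G h2)) <= b * hn (h1 - h2).
    set p := hn (Bs _) in n2 n3 *; set q := hn (h1 - h2) in n2 *.
    have p0 : 0 <= p by exact: hn_ge0.
    have : p ^+ 2 <= (s * N (G h1 - G h2)) ^+ 2.
      by rewrite ler_pXn2r ?nnegrE ?mulr_ge0 ?fnorm_ge0 ?sqrtr_ge0.
    rewrite exprMn s2 => n5.
    have n6 : p * p <= (b * q) * p.
      rewrite -expr2 (le_trans n5)// -mulrA ler_pM2l//.
    have [p1|p1] := eqVneq p 0; first by rewrite p1 mulr_ge0 ?hn_ge0// ltW.
    by move: n6; rewrite ler_pM2r// lt_neqAle eq_sym p1.
  have n5 := Rz_bound zD D_low (Bs (G h1 - G h2)).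
  by rewrite mulrAC ler_pdivlMr// mulrC; exact: le_trans n5 n4.
have [Vx hx] := hG h'.
have E w : V w -> f (G h') w + '[Rz (Bs (G h')), Bs w] = '[h, Bs w].
  by move=> Vw; rewrite hx// -linearDl {1}hh /phi subrK.
exists (G h'); split => //.
have /(congr1 (@complex.Re R)) := E _ Vx; rewrite ReD -/(rip _ _) -/(rip _ _) -/(rform f _ _).
rewrite -(fnorm_sqr f_pos)//; set x := G h'; move=> e1.
have e2 := rip_CS (Rz (Bs x)) (Bs x); have e3 := rip_CS h (Bs x).
have e4 := Bs_bound Vx; have e5 := Rz_bound zD D_low (Bs x).
rewrite -/x in e4.
have n0 := fnorm_ge0 f x; have [n1|n1] := eqVneq (N x) 0.
  by rewrite n1 mulr0 !mulr_ge0 ?hn_ge0 ?(ltW d0) ?(ltW s0).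
have {}n1 : 0 < N x by rewrite lt_neqAle eq_sym n1.
rewrite -(ler_pM2r n1).
have B0 := hn_ge0 (Bs x); have h0 := hn_ge0 h.
have e6 : d * hn (Rz (Bs x)) * hn (Bs x) <= (s * N x) * (s * N x).
  by apply: ler_pM; rewrite ?hn_ge0 ?mulr_ge0 ?hn_ge0 ?(ltW d0)//; exact: le_trans e5 e4.
have e7 : (s * N x) * (s * N x) = b * N x ^+ 2 by rewrite mulrACA -!expr2 s2.
have e8 : d * (hn h * hn (Bs x)) <= d * (hn h * (s * N x)) by rewrite ler_pM2l// ler_wpM2l.
have e9 : d * N x ^+ 2 <= d * (hn h * hn (Bs x)) + d * (hn (Rz (Bs x)) * hn (Bs x)).
  rewrite -mulrDr ler_pM2l//; move: e2 e3; rewrite !ler_norml => /andP[? _] /andP[_ ?]; lra.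
lra.
Qed.

(** [x1] solves the equation of [s(z)] shifted by [k + z] with source [- Rz g]. Subtracting it
    removes [g] from the form equation, and the shift reappears as [(k + z) x1], a genuine vector of
    [H1] that [S] can handle. *)
Lemma schur_reduction g : exists x1, [/\ V x1, (d - b) * hn x1 <= s * hn g &
  forall x F, V x ->
  (forall w, V w -> a x w - z * '[x, w] + '[Rz (g + Bs x), Bs w] = '[F, w]) <->
  S (x - x1, F + (k%:C + z) *: x1)].
Proof.
have [x1 [V1 n1 h1]] := coercive_solve (- Rz g).
exists x1; split => //.
  have := hn_le_fnorm (f := f) coer V1; rewrite hnN in n1.
  have := Rz_bound zD D_low g => h2 h3.
  have h4 : (d - b) * hn x1 <= (d - b) * N x1 by rewrite ler_pM2l.
  have h5 : s * (d * hn (Rz g)) <= s * hn g by rewrite ler_pM2l.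
  lra.
move=> x F Vx; have Vd := fdomB a_sym Vx V1.
have E w : V w -> a (x - x1) w - z * '[x - x1, w] + '[Rz (Bs (x - x1)), Bs w] -
    '[F + (k%:C + z) *: x1, w] =
    a x w - z * '[x, w] + '[Rz (g + Bs x), Bs w] - '[F, w].
  move=> Vw; have := h1 w Vw.
  rewrite BsB// !RzD RzN (fformBl a_sym)// linearBl/= !linearDl/= linearZl_LR/= !linearNl/=.
  move=> /= h; have -> : '[Rz g, Bs w] =
      - (a x1 w + k%:C * '[x1, w] + '[Rz (Bs x1), Bs w]) by rewrite h opprK.
  ring.
split=> [h|[_ h] w Vw].
  by split => //= w Vw; apply/eqP; rewrite -subr_eq0 E// subr_eq0; apply/eqP/h.
by apply/eqP; rewrite -subr_eq0 -E// subr_eq0; apply/eqP; exact: (h w Vw).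
Qed.

Lemma schur_lin c x y F G : S (x, F) -> S (y, G) -> S (c *: x + y, c *: F + G).
Proof.
move=> [/= Vx hx] [/= Vy hy]; split => [|w Vw] /=; first exact: fdomZD.
rewrite (fformZDl a_sym)// (BsZD a_sym B_dense dom_a)// [app (inv_op _) _]RzZD.
rewrite !linearPl/= -hx// -hy//; ring.
Qed.

Lemma schur0 : S (0, 0).
Proof.
split => [|w Vw] /=; first exact: fdom0.
rewrite (fform0l a_sym)// (Bs0 a_sym B_dense dom_a) [app (inv_op _) _]Rz0.
by rewrite !linear0l mulr0 subr0 add0r.
Qed.

Lemma schur_weak x F : S (x, F) <-> W ((x, Rz (Bs x)), (F + z *: x, z *: Rz (Bs x))).
Proof.
rewrite -[z *: Rz _]add0r weak_shiftP add0r; split=> [[/= Vx h]|[Vx _ h]]; split => //.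
Qed.

Lemma weak_resolvent_schur : resolvent_set W z -> resolvent_set S 0.
Proof.
move=> [bij [c hc]]; split=> [F|].
  have [[x y] [Wxy xyu]] := bij (F, 0).
  move: Wxy; rewrite /shift_op/= => /weak_shiftP[Vx yx h]; rewrite add0r in yx.
  exists x; split=> [|x']; rewrite /shift_op/= scale0r addr0.
    by split => //= w Vw; rewrite -h// yx.
  move=> /schur_weak Wx'; have := xyu (x', Rz (Bs x')); rewrite weak_shiftE add0r => /(_ Wx').
  by case.
exists c => x F; rewrite /shift_op/= scale0r addr0 => /schur_weak Wx.
have := hc (x, Rz (Bs x)) (F, 0); rewrite weak_shiftE add0r => /(_ Wx).
rewrite !normE_pair -!rmorphM/= hn0 lecR [Num.max _ 0]max_l ?hn_ge0// !normE -rmorphM/= lecR.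
by apply: le_trans; rewrite le_max lexx.
Qed.

Lemma schur_resolvent_weak : resolvent_set S 0 -> resolvent_set W z.
Proof.
move=> [bij [c hc]].
have bij1 F : exists! x, S (x, F).
  have [x [Sx xu]] := bij F; exists x; move: Sx; rewrite /shift_op/= scale0r addr0 => Sx.
  by split => // x' Sx'; apply: xu; rewrite /shift_op/= scale0r addr0.
have hc1 x F : S (x, F) -> hn x <= c * hn F.
  move=> SxF; have := hc x F; rewrite /shift_op/= scale0r addr0 => /(_ SxF).
  by rewrite !normE -rmorphM/= lecR.
split=> [[F g]|].
  have [x1 [V1 _ h1]] := schur_reduction g.
  have [x2 [S2 x2u]] := bij1 (F + (k%:C + z) *: x1).
  have V2 : V x2 by case: S2.
  have Vx := fdomD a_sym V2 V1.
  exists (x2 + x1, Rz (g + Bs (x2 + x1))); split.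
    apply/weak_shiftP; split => //.
    by apply/(h1 _ F Vx); rewrite addrK.
  move=> [x y] /weak_shiftP[Vx' -> /(h1 _ F Vx') /x2u ->].
  by rewrite subrK.
(* With [m] the norm of the right-hand side, [c1 m] bounds [x1], [c2 m] bounds [x],
   [c3 / (d - b) * m] its form norm, and [c4 m] bounds [y]. The detour through the form norm is due
   to [Bs x], which [hn x] does not control. *)
pose c1 := s / (d - b); pose kz := Normc.normc (k%:C + z); pose nz := Normc.normc z.
pose c2 := `|c| * (1 + kz * c1) + c1.
pose c3 := d * (1 + (`|k| + nz) * c2) + s.
pose c4 := (1 + s * (c3 / (d - b))) / d.
have kz0 : 0 <= kz by rewrite /kz; case: (_ + _) => ? ?; exact: sqrtr_ge0.
have nz0 : 0 <= nz by rewrite /nz; case: (z) => ? ?; exact: sqrtr_ge0.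
have c10 : 0 <= c1 by rewrite divr_ge0 ?ltW.
have c20 : 0 <= c2 by rewrite addr_ge0// mulr_ge0// addr_ge0// mulr_ge0.
have k0 := normr_ge0 k.
have c30 : 0 <= c3.
  by rewrite addr_ge0 ?(ltW s0)// mulr_ge0 ?(ltW d0)// addr_ge0// mulr_ge0// addr_ge0.
have c40 : 0 <= c4.
  by rewrite divr_ge0 ?(ltW d0)// addr_ge0// mulr_ge0 ?(ltW s0)// divr_ge0// ltW.
exists (c2 + c4) => -[x y] [F g]; rewrite weak_shiftE => Wxy.
have [Vx yx h] := (weak_shiftP x y F g).1 Wxy.
rewrite !normE_pair -rmorphM/= lecR; set m := Num.max (hn F) (hn g).
have Fm : hn F <= m by rewrite le_max lexx.
have gm : hn g <= m by rewrite le_max lexx orbT.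
have m0 : 0 <= m by exact: le_trans (hn_ge0 F) Fm.
have [x1 [V1 b1 h1]] := schur_reduction g.
have x1m : hn x1 <= c1 * m.
  rewrite /c1 mulrAC ler_pdivlMr// mulrC; apply: le_trans b1 _.
  by rewrite ler_pM2l.
have xm : hn x <= c2 * m.
  have : S (x - x1, F + (k%:C + z) *: x1) by apply/h1 => // w Vw; rewrite -yx; exact: h.
  move=> /hc1 l1; have := hnD (x - x1) x1; rewrite subrK => l2.
  have := hnD F ((k%:C + z) *: x1); rewrite hnZ -/kz => l3.
  have l4 : kz * hn x1 <= kz * (c1 * m) by rewrite ler_wpM2l.
  have l5 : c * hn (F + (k%:C + z) *: x1) <= `|c| * (m + kz * (c1 * m)).
    apply: le_trans (_ : `|c| * hn (F + (k%:C + z) *: x1) <= _).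
      by rewrite ler_wpM2r ?hn_ge0// ler_norm.
    by rewrite ler_wpM2l//; lra.
  rewrite /c2; lra.
have Nm : N x <= c3 / (d - b) * m.
  rewrite mulrAC ler_pdivlMr// mulrC.
  case: Wxy => _ /= Dy W3.
  have := @weak_estimate _ _ _ B D a dom_a b k b0 coer B_bound z d bd D_low
    x y _ (F + z *: x + k%:C *: x) g Vx Dy.
  rewrite addrAC addrK => /(_ erefl) est.
  apply: le_trans (est _) _; first exact/(weak_rowP a_sym B_dense dom_a k y (F + z *: x) Vx).
  have := hnD (F + z *: x) (k%:C *: x); rewrite hnZ/= expr0n addr0 sqrtr_sqr => l1.
  have := hnD F (z *: x); rewrite hnZ -/nz => l2.
  have l3 : (`|k| + nz) * hn x <= (`|k| + nz) * (c2 * m) by rewrite ler_wpM2l ?addr_ge0.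
  have l4 : d * hn (F + z *: x + k%:C *: x) <= d * (m + (`|k| + nz) * (c2 * m)).
    by rewrite ler_pM2l//; lra.
  have l5 : s * hn g <= s * m by rewrite ler_pM2l.
  rewrite /c3; lra.
have ym : hn y <= c4 * m.
  rewrite /c4 mulrAC ler_pdivlMr// mulrC yx; apply: le_trans (Rz_bound zD D_low _) _.
  have := hnD g (Bs x); have := Bs_bound Vx.
  have : s * N x <= s * (c3 / (d - b) * m) by rewrite ler_pM2l.
  lra.
have c2m : 0 <= c2 * m by rewrite mulr_ge0.
have c4m : 0 <= c4 * m by rewrite mulr_ge0.
by rewrite ge_max; apply/andP; split; lra.
Qed.

Lemma schur_point : point_spectrum S 0 <-> point_spectrum W z.
Proof.
split=> [[x x0]|[[x y] xy0]].
  rewrite scale0r => /schur_weak; rewrite add0r => Wx.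
  by exists (x, Rz (Bs x)) => //; apply: contra_neq x0 => -[].
have -> : z *: (x, y) = (0 + z *: x, 0 + z *: y) by rewrite !add0r.
move=> /weak_shiftP[Vx]; rewrite add0r => yx h; exists x.
  by apply: contra_neq xy0 => x0; rewrite yx x0 (Bs0 a_sym B_dense dom_a) Rz0.
by rewrite scale0r; split => //= w Vw; rewrite -h// yx.
Qed.

Lemma schur_ker x y : shift_op W z ((x, y), 0) <-> S (x, 0) /\ y = Rz (Bs x).
Proof.
rewrite /shift_op/=.
have -> : 0 + z *: (x, y) = (0 + z *: x, 0 + z *: y) by rewrite !add0r.
split=> [/weak_shiftP[Vx]|[/schur_weak + ->]]; last by rewrite [0 + z *: Rz _]add0r.
by rewrite add0r => yx h; split => //; split => //= w Vw; rewrite -h// yx.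
Qed.

End SchurComplement.

(** * Algebraic bases and equality of dimensions *)

Section HamelBasis.
Variable R : realType.
Implicit Types V W : normedModType R[i].

Definition subspace V (E : set V) :=
  E 0 /\ forall (c : R[i]) x y, E x -> E y -> E (c *: x + y).

Definition lin_indep V (X : set V) := forall n (v : 'I_n -> V) (c : 'I_n -> R[i]),
  injective v -> (forall i, X (v i)) ->
  \sum_(i < n) c i *: v i = 0 -> forall i, c i = 0.

(** For Zorn's lemma: a linear relation in the union of a chain involves finitely many vectors,
    hence lives in one member. The list is nonempty because an empty chain has no member to
    offer. *)
Lemma chain_finite V (F : set (set V)) x0 (s : seq V) : total_on F subset ->
  (forall x, x \in x0 :: s -> (\bigcup_(X in F) X) x) ->
  exists2 X, F X & forall x, x \in x0 :: s -> X x.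
Proof.
move=> Ftot; elim: s x0 => [|x1 s ih] x0 h.
  have [X FX Xx] := h x0 (mem_head _ _).
  by exists X => // x; rewrite inE => /eqP ->.
have [|X FX hX] := ih x1; first by move=> x xs; apply: h; rewrite inE xs orbT.
have [Y FY Yx] := h x0 (mem_head _ _).
have [XY|YX] := Ftot _ _ FX FY.
  by exists Y => // x; rewrite inE => /orP[/eqP ->//|/hX /XY].
by exists X => // x; rewrite inE => /orP[/eqP ->|/hX//]; exact: YX.
Qed.

(** A relation with nonzero coefficient at [x] could be solved for [x]. *)
Lemma lin_indep_add V (X : set V) x : lin_indep X ->
  ~ (exists n (v : 'I_n -> V) (c : 'I_n -> R[i]),
      (forall i, X (v i)) /\ x = \sum_(i < n) c i *: v i) ->
  lin_indep (X `|` [set x]).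
Proof.
move=> Xf xX n v c vi Xv s0.
have [[i0 vx]|h] := pselect (exists i0, v i0 = x); last first.
  by apply: (Xf n v) => // i; case: (Xv i) => // vx; case: h; exists i.
case: n v c vi Xv s0 i0 vx => [|n] v c vi Xv s0 i0 vx; first by have := ltn_ord i0.
have Xl j : X (v (lift i0 j)).
  case: (Xv (lift i0 j)) => // vl; have := neq_lift i0 j.
  by rewrite -(inj_eq vi) vx vl eqxx.
have vli : injective (fun j => v (lift i0 j)) by move=> i j /vi /lift_inj.
rewrite (bigD1_ord i0)//= vx in s0.
have c0 : c i0 = 0.
  apply/eqP/negP => /negP ci0; apply: xX.
  exists n, (fun j => v (lift i0 j)), (fun j => - (c i0)^-1 * c (lift i0 j)); split => //.
  have /eqP := s0; rewrite addrC addr_eq0 => /eqP sE.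
  rewrite (eq_bigr (fun j => (- (c i0)^-1) *: (c (lift i0 j) *: v (lift i0 j)))); last first.
    by move=> j _; rewrite scalerA.
  by rewrite -scaler_sumr sE scaleNr scalerN opprK scalerA mulVf// scale1r.
rewrite c0 scale0r add0r in s0.
have cl := Xf n _ _ vli Xl s0.
by move=> i; case: (unliftP i0 i) => [j ->|->]; [exact: cl|].
Qed.

Lemma hamel_exists V (E : set V) : subspace E -> exists X, hamel_basis E X.
Proof.
move=> [E0 EZD].
have [F FP Ftot|X [[XE Xf] Xmax]] := @Zorn_bigcup _ [set X : set V | X `<=` E /\ lin_indep X].
  split=> [x [X FX Xx]|n v c vi Fv s0 i]; first by have [XE _] := FP _ FX; exact: XE.
  have [|X FX hX] := @chain_finite _ F (v i) (codom v) Ftot.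
    by move=> x; rewrite inE => /orP[/eqP ->//|/codomP[j ->]].
  have [_ Xf] := FP _ FX; apply: (Xf n v c vi _ s0) => j.
  by apply: hX; rewrite inE codom_f orbT.
exists X; split => // x Ex; apply: contrapT => hx.
apply: (Xmax (X `|` [set x])).
  split; first by move=> y; left.
  move=> h; have Xx : X x by apply: h; right.
  apply: hx; exists 1%N, (fun=> x), (fun=> 1); split => //.
  by rewrite big_ord1 scale1r.
split; first by move=> y [/XE//|->].
exact: lin_indep_add.
Qed.

(** An injective linear map carries a basis to a basis of the image. Linearity is asked on [E]
    alone, since [app (adjoint B)] is known to be linear only on the form domain. *)
Lemma dim_eq_linear V W (E : set V) (phi : V -> W) : subspace E ->
  (forall (c : R[i]) x y, E x -> E y -> phi (c *: x + y) = c *: phi x + phi y) ->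
  (forall x, E x -> phi x = 0 -> x = 0) -> dim_eq E (phi @` E).
Proof.
move=> Esub phiZD phi0; have [E0 EZD] := Esub.
have [X [XE Xf Xspan]] := hamel_exists Esub.
have p0 : phi 0 = 0.
  by have := phiZD (-1) 0 0 E0 E0; rewrite scaler0 addr0 scaleN1r addNr.
have phi_sum n (v : 'I_n -> V) (c : 'I_n -> R[i]) : (forall i, E (v i)) ->
    E (\sum_(i < n) c i *: v i) /\
    phi (\sum_(i < n) c i *: v i) = \sum_(i < n) c i *: phi (v i).
  elim: n v c => [|n ih] v c Ev; first by rewrite !big_ord0.
  have [Es ps] := ih (fun i => v (lift ord0 i)) (fun i => c (lift ord0 i)) (fun i => Ev _).
  by rewrite !big_ord_recl phiZD// ps; split => //; exact: EZD.
have phi_inj : {in X &, injective phi}.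
  move=> x y /set_mem/XE Ex /set_mem/XE Ey pxy; apply/eqP; rewrite -subr_eq0; apply/eqP.
  rewrite addrC -scaleN1r; apply: phi0; first exact: EZD.
  by rewrite phiZD// pxy scaleN1r addNr.
exists X, (phi @` X); split.
- by split.
- split=> [_ [x Xx <-]|n v c vi Xv s0|_ [x Ex <-]].
  + by exists x => //; exact: XE.
  + have [u hu] : {u : 'I_n -> V & forall i, X (u i) /\ phi (u i) = v i}.
      apply: (@choice _ _ (fun i x => X x /\ phi x = v i)) => i.
      by have [x Xx <-] := Xv i; exists x.
    have Xu i : X (u i) by case: (hu i).
    have [Es ps] := phi_sum n u c (fun i => XE _ (Xu i)).
    apply: (Xf n u) => //.
      by move=> i j uij; apply: vi; rewrite -(hu i).2 -(hu j).2 uij.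
    apply: phi0 => //; rewrite ps -[RHS]s0; apply: eq_bigr => i _.
    by rewrite (hu i).2.
  + have [n [v [c [Xv ->]]]] := Xspan x Ex.
    exists n, (fun i => phi (v i)), c; split; first by move=> i; exists (v i).
    by have [] := phi_sum n v c (fun i => XE _ (Xv i)).
- by rewrite card_eq_sym; exact: inj_card_eq.
Qed.

End HamelBasis.

(** In the first case the core supplies the approximating pairs. In the second, [dom D] lies in
    [fdom d] and so in [dom B], and every pair approximates itself. *)
Lemma core_approx (R : realType) (H1 H2 : hilbertType R)
  (B : operator H2 H1) (D : operator H2 H2) (d : sesq H2) :
  closed_form_of (opp_op D) (opp_form d) ->
  (dom B `<=` dom D /\ is_core D (dom B)) \/ fdom d `<=` dom B ->
  forall y w, D (y, w) -> forall e : R, 0 < e ->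
  exists y' w' v', [/\ D (y', w'), B (y', v'), hn (y - y') < e & hn (w - w') < e].
Proof.
move=> [_ _ _ _ d_op] [[_ [_ D_core]]|dB] y w Dyw e e0.
  move: Dyw; rewrite -{1}D_core => /closureP_pair /(_ e e0).
  by move=> [y' [w' [[/= Dyw [v' Bv]] hy hw]]]; exists y', w', v'.
have : opp_op D (y, - w) by rewrite /opp_op/= opprK.
rewrite -d_op => -[/= dy _]; have [v Bv] := dB _ dy.
by exists y, w, v; rewrite !subrr !hn0.
Qed.

Theorem theorem3p6 (R : realType) (H1 H2 : hilbertType R)
  (H1_neq0 : exists x : H1, x != 0) (H2_neq0 : exists x : H2, x != 0)
  (A : operator H1 H1) (B : operator H2 H1) (D : operator H2 H2)
  (a : sesq H1) (d : sesq H2)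
  (A_sa : self_adjoint A) (A_below : bounded_below A)
  (B_lin : linear_operator B) (B_dense : densely_defined B)
  (B_closable : closable B)
  (D_sa : self_adjoint D) (D_above : bounded_above D)
  (a_form : closed_form_of A a)
  (d_form : closed_form_of (opp_op D) (opp_form d))
  (dom_a : fdom a `<=` dom (adjoint B))
  (cases : (dom B `<=` dom D /\ is_core D (dom B)) \/ fdom d `<=` dom B) :
  let M := closure (block_op A B D) in
  let U := schur_domain B D a in
  [/\ schur_spectrum B D a = spectrum M `&` U,
      schur_point_spectrum B D a = point_spectrum M `&` U &
      forall z, U z ->
        dim_eq (ker_op (schur_complement B D a z)) (ker_op (shift_op M z))].
Proof.
move=> M U; have [_ a_sym a_below a_closed A_form] := a_form.
have D_core := core_approx d_form cases.
have main z : U z -> [/\ spectrum (schur_complement B D a z) 0 <-> spectrum M z,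
    point_spectrum (schur_complement B D a z) 0 <-> point_spectrum M z &
    dim_eq (ker_op (schur_complement B D a z)) (ker_op (shift_op M z))].
  move=> Uz.
  have [b [k [/andP[b0 bd] coer B_bound]]] :=
    relative_bound_gt a_sym a_below a_closed B_lin B_dense dom_a Uz.
  have [zD D_low] := sa_dist D_sa (lt_trans b0 bd).
  have D_lin : linear_operator D by case: D_sa.
  rewrite /M (closure_block a_sym a_closed A_form B_dense dom_a D_sa D_core b0 coer B_bound bd D_low).
  split.
  - split; apply: contra_not.
      exact: (weak_resolvent_schur zD).
    exact: (schur_resolvent_weak a_sym a_closed B_dense dom_a D_sa b0 coer B_bound bd zD D_low).
  - exact: (schur_point a_sym B_dense dom_a D_sa zD).
  set S := schur_complement B D a z.
  (* The kernel is a graph over [ker_op S]; the first component makes this parametrisation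
     injective. *)
  have -> : ker_op (shift_op (weak_block B D a) z) =
      (fun x => (x, resol D z (app (adjoint B) x))) @` ker_op S.
    apply/seteqP; split=> [[x y] /(schur_ker B a zD)[Sx ->]|_ [x Sx <-]].
      by exists x.
    by apply/(schur_ker B a zD).
  have BsZD := BsZD a_sym B_dense dom_a.
  have lin := fun c x y => resolZD D_lin c x y zD.
  have SV x : ker_op S x -> fdom a x by case.
  apply: dim_eq_linear => [|c x y Sx Sy|x _ []//].
    split=> [|c x y Sx Sy]; first exact: (schur0 a_sym B_dense dom_a D_sa zD).
    by have := schur_lin a_sym B_dense dom_a D_sa zD c Sx Sy; rewrite scaler0 addr0.
  by rewrite BsZD ?lin//; exact: SV.
split.
- apply/seteqP; split=> z [].
    by move=> Uz Sz; have [E _ _] := main z Uz; split => //; exact/E.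
  by move=> Mz Uz; have [E _ _] := main z Uz; split => //; exact/E.
- apply/seteqP; split=> z [].
    by move=> Uz Sz; have [_ E _] := main z Uz; split => //; exact/E.
  by move=> Mz Uz; have [_ E _] := main z Uz; split => //; exact/E.
- by move=> z /main[].
Qed.
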